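(* Let $(X,\mathfrak{T})$ be a regular, second countable topological space. Let $\mu$ be a Borel measure on $X$ that is $\mathcal{G}_\delta$-regular and such that $X$ is $\sigma$-finite with respect to $\mu$. Assume further that $X$ can be written as the union of countably many compact sets and a set of $\mu$-measure zero. Let $(Y,d)$ be a metric space and $h$ a Hausdorff function of finite order with $h(0)=0$, and assume that $Y$ is not $\sigma$-finite with respect to the Hausdorff measure $\mathcal{H}^h$. If $f\colon X\to Y$ is a measurable surjection, then there exists a set $N\subset X$ with $\mu(N)=0$ and $\mathcal{H}^h(f(N))>0$.
   Context: Measures are outer measures: a measure on a set $X$ is a map $\mu\colon\mathcal{P}(X)\to[0,\infty]$ with $\mu(\emptyset)=0$ and $\mu(A)\le\sum_{i=1}^\infty\mu(A_i)$ whenever $A\subset\bigcup_{i=1}^\infty A_i$. A set $M$ is $\mu$-measurable if $\mu(F)=\mu(F\cap M)+\mu(F\setminus M)$ for all $F\subset X$. $\mu$ is Borel if every Borel set is $\mu$-measurable. A set is $\sigma$-finite with respect to $\mu$ if it is a countable union of $\mu$-measurable sets of finite measure. $\mu$ is $\mathcal{G}_\delta$-regular if for every $E\subset X$ there is a $G_\delta$-set $R\supset E$ with $\mu(R)=\mu(E)$. A map $f$ from a measure space $(X,\mu)$ to a topological space is measurable if the preimage of every open set is $\mu$-measurable. A topological space is regular if points are closed and any point and any closed set not containing it can be separated by disjoint open sets. It is second countable if it has a countable basis. A Hausdorff function is a function $h\colon[0,\infty)\to[0,\infty)$ that is non-decreasing, continuous from the right, with $h(t)>0$ for $t>0$. It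 is of finite order if $\limsup_{t\to0+}h(3t)/h(t)<\infty$. For $E$ in a metric space, $\mathcal{H}^h(E)=\sup_{\delta>0}\mathcal{H}^h_\delta(E)$, where $\mathcal{H}^h_\delta(E)$ is the infimum of $\sum_{i=1}^\infty h(\operatorname{diam}U_i)$ over all countable covers $(U_i)_i$ of $E$ with $\operatorname{diam}U_i\le\delta$ (empty $U_i$ contribute $0$, and $\inf\emptyset=\infty$). *)

(* Defs.v *)
From HB Require Import structures.
From mathcomp Require Import all_boot all_order all_algebra.
From mathcomp Require Import all_classical all_reals all_analysis.
From mathcomp Require Import borel_hierarchy.

Set Implicit Arguments.
Unset Strict Implicit.
Unset Printing Implicit Defensive.

Import Order.TTheory GRing.Theory Num.Theory.
Import numFieldNormedType.Exports.

Local Open Scope classical_set_scope.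
Local Open Scope ring_scope.

(* Unlike the library's [regular_space], this includes the T1 axiom. *)
Definition regular_T1_space (X : topologicalType) : Prop :=
  (forall x : X, closed [set x]) /\
  (forall (x : X) (C : set X), closed C -> ~ C x ->
    exists U V : set X,
      [/\ open U, open V, U x, C `<=` V & U `&` V = set0]).

(* The next four notions are stated for a set function [mu]; they are meant
   for outer measures, [mu]-measurability being Caratheodory's. *)
Definition borel_outer (R : realType) (X : topologicalType)
    (mu : set X -> \bar R) : Prop :=
  forall A : set X, <<s @open X >> A -> caratheodory_measurable mu A.

Definition Gdelta_regular (R : realType) (X : topologicalType)
    (mu : set X -> \bar R) : Prop :=
  forall E : set X, exists G : set X, [/\ Gdelta G, E `<=` G & mu G = mu E].

Definition sigma_finite_set (R : realType) (T : Type)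
    (mu : set T -> \bar R) (A : set T) : Prop :=
  exists F : nat -> set T,
    (forall i, caratheodory_measurable mu (F i) /\ (mu (F i) < +oo)%E) /\
    A = \bigcup_i F i.

Definition outer_measurable_fun (R : realType) (X : Type)
    (Y : topologicalType) (mu : set X -> \bar R) (f : X -> Y) : Prop :=
  forall O : set Y, open O -> caratheodory_measurable mu (f @^-1` O).

(* A function [0, oo) -> [0, oo) is given by a total [h : R -> R] whose values
   at negative arguments are irrelevant. *)
Definition hausdorff_function (R : realType) (h : R -> R) : Prop :=
  [/\ forall t, 0 <= t -> 0 <= h t,
      forall s t, 0 <= s -> s <= t -> h s <= h t,
      forall t, 0 <= t -> h x @[x --> t^'+] --> h t
    & forall t, 0 < t -> 0 < h t].

Definition finite_order (R : realType) (h : R -> R) : Prop :=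
  (limf_esup (fun t : R => (h (3 * t) / h t)%:E) (0:R)^'+ < +oo)%E.

Section hausdorff_measure.
Context {R : realType} {Y : metricType R}.
Implicit Types (h : R -> R) (U E : set Y).

(* Equal to -oo when [U] is empty. *)
Definition diam U : \bar R :=
  ereal_sup [set (mdist p.1 p.2)%:E | p in U `*` U].

(* Only used for [U] of finite diameter, so [fine] loses nothing. *)
Definition hausdorff_gauge h U : \bar R :=
  if U == set0 then 0%E else (h (fine (diam U)))%:E.

Definition hausdorff_content h (delta : R) E : \bar R :=
  ereal_inf [set (\sum_(0 <= i <oo) hausdorff_gauge h (U i))%E
            | U in [set U : nat -> set Y |
                (forall i, (diam (U i) <= delta%:E)%E) /\
                E `<=` \bigcup_i U i]].

Definition hausdorff_measure h E : \bar R :=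
  ereal_sup [set hausdorff_content h delta E | delta in [set d : R | 0 < d]].

End hausdorff_measure.

(* Main.v *)
Require Import Defs.
From HB Require Import structures.
From mathcomp Require Import all_boot all_order all_algebra.
From mathcomp Require Import all_classical all_reals all_analysis.
From mathcomp Require finmap.
From mathcomp Require Import wochoice borel_hierarchy lra.

Set Implicit Arguments.
Unset Strict Implicit.
Unset Printing Implicit Defensive.

Import Order.TTheory GRing.Theory Num.Theory.
Import numFieldNormedType.Exports.

Local Open Scope classical_set_scope.
Local Open Scope ring_scope.

(** Suppose that [f] maps every [mu]-null set to an [H^h]-null set; then [Y] is
    sigma-finite for [H^h].

    First, [Y] is separable. If uncountably many disjoint balls of a fixed radius
    existed, every uncountable union of them would have a preimage of positive
    measure, because its image is not separable and hence not [H^h]-null. But an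
    uncountable set splits into uncountably many disjoint uncountable sets, which
    contradicts sigma-finiteness of [mu].

    By Lusin's theorem, up to a null set [X] is then a countable union of compact
    sets [L] of finite measure on which [f] is continuous. Let [nu] be the image
    under [f] of the restriction of [mu] to [L]. By the Vitali covering lemma the
    points at which the upper density of [nu] with respect to [h] is at least
    [1 / n] form a set of finite [H^h]-measure. If the points of density zero had
    positive [nu]-measure, then by Egorov's argument [nu (ball y r) = o(h r)]
    would hold uniformly on the image of a compact set of positive measure.
    Concentrating [nu] on ever smaller subsets of ever smaller pieces, with a
    density that grows at most by a factor 8 per step, yields measures that stay
    below [h] on all small sets while their carriers decrease to a [mu]-null set.
    The mass distribution principle shows that the image of this null set has
    positive [H^h]-measure, a contradiction. *)

(** * Outer measures *)

Section outer_measure_facts.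
Context {R : realType} {T : Type} (mu : {outer_measure set T -> \bar R}).
Local Open Scope ereal_scope.

Lemma caratheodory_measurable_bigcap (A : (set T)^nat) :
  (forall n, mu.-caratheodory (A n)) -> mu.-caratheodory (\bigcap_n A n).
Proof.
move=> mA; rewrite -(setCK (\bigcap_n A n)) setC_bigcap.
apply: caratheodory_measurable_setC; apply: caratheodory_measurable_bigcup => n.
exact: caratheodory_measurable_setC.
Qed.

Lemma outer_measure_bigcup_null (N : (set T)^nat) :
  (forall n, mu (N n) = 0) -> mu (\bigcup_n N n) = 0.
Proof.
move=> N0; apply/eqP; rewrite eq_le outer_measure_ge0 andbT.
by rewrite (le_trans (outer_measure_sigma_subadditive mu N))// eseries0.
Qed.

Lemma outer_measure_bigcup_geo (A : (set T)^nat) (e : R) : (0 <= e)%R ->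
  (forall n, mu (A n) <= (e / (2 ^ n.+1)%:R)%:E) ->
  mu (\bigcup_n A n) <= e%:E.
Proof.
move=> e0 Ae; apply: le_trans (outer_measure_sigma_subadditive mu A) _.
apply: le_trans (epsilon_trick0 xpredT e0); apply: lee_nneseries => [n _ _|n _]; last exact: Ae.
exact: outer_measure_ge0.
Qed.

(** [A] is arbitrary. Its traces on the disjoint differences [seqD D] have summable measures,
    bounded by [mu A], and [A] outside [D n] is covered by the traces from index [n] on, a vanishing
    tail. *)
Lemma caratheodory_setD_lt (A : set T) (D : (set T)^nat) (e : R) :
  mu A < +oo -> (forall n, mu.-caratheodory (D n)) ->
  nondecreasing_seq D -> A `<=` \bigcup_n D n -> (0 < e)%R ->
  exists n, mu (A `\` D n) < e%:E.
Proof.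
move=> Aoo mD ndD AD e0.
have mseq n : mu.-caratheodory (seqD D n).
  by case: n => [|n] /=; [exact: mD|apply: caratheodory_measurable_setD; exact: mD].
have tD : trivIset setT (seqD D) by exact: trivIset_seqD.
have le1 := caratheodory_lime_le mseq tD A.
have sumoo : \sum_(k <oo) mu (A `&` seqD D k) < +oo.
  apply: le_lt_trans Aoo; apply: le_trans le1.
  by rewrite leeDl// outer_measure_ge0.
have := nneseries_tail_cvg sumoo (fun k _ => outer_measure_ge0 mu (A `&` seqD D k)).
move=> /fine_cvgP[_ /cvgrPdist_lt/(_ _ e0)[N _ NP]].
have tail_fin : \sum_(N <= k <oo) mu (A `&` seqD D k) \is a fin_num.
  rewrite ge0_fin_numE; last first.
    by apply: nneseries_ge0 => k _ _; exact: outer_measure_ge0.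
  apply: le_lt_trans sumoo.
  rewrite [leRHS](nneseries_split 0 N); last by move=> k _; exact: outer_measure_ge0.
  by rewrite add0n leeDr// sume_ge0// => i _; exact: outer_measure_ge0.
exists N.
have : A `\` D N `<=` \bigcup_(n in ~` `I_N) (A `&` seqD D n).
  move=> x [Ax nDx]; have [m _ Dmx] := AD _ Ax.
  have : (\bigcup_n seqD D n) x by rewrite eq_bigcup_seqD; exists m.
  move=> [k _ Dkx]; exists k => //=; apply/negP; rewrite -leqNgt leqNgt; apply/negP => kN.
  apply: nDx; suff : D k x by apply/subsetPset/ndD; exact: ltnW.
  by case: k Dkx {kN} => //= k [].
move=> /(le_outer_measure mu)/le_lt_trans; apply.
apply: le_lt_trans (outer_measure_sigma_subadditive_tail mu N _) _.
have := NP N (leqnn N); rewrite /= sub0r normrN ger0_norm; last first.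
  by rewrite fine_ge0//; apply: nneseries_ge0 => k _ _; exact: outer_measure_ge0.
by move=> ?; rewrite -(fineK tail_fin) lte_fin.
Qed.

End outer_measure_facts.

(** * Caratheodory's criterion for metric outer measures *)

Section caratheodory_criterion.
Context {R : realType} {Y : metricType R}.
Variable mu : {outer_measure set Y -> \bar R}.
Hypothesis mu_sep : forall (A B : set Y) (e : R), 0 < e ->
  (forall a b, A a -> B b -> e <= mdist a b) ->
  (mu A + mu B <= mu (A `|` B))%E.

(** [X] outside [C] is exhausted by the sets [D n] of points at distance at least [e n] from [C].
    Each [D n] is separated from [C], so its measure adds to that of the trace on [C]; what remains
    is a tail of shells with summable measures. *)
Lemma caratheodory_closed (C : set Y) : closed C -> mu.-caratheodory C.
Proof.
move=> cC; apply: le_caratheodory_measurable => X.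
have [->|Xoo] := eqVneq (mu X) +oo%E; first exact: leey.
have {}Xoo : (mu X < +oo)%E by rewrite ltey.
pose e n : R := n.+1%:R^-1.
have e_gt0 n : 0 < e n by rewrite /e invr_gt0.
have e_lt m n : (m < n)%N -> e n < e m by move=> mn; rewrite /e ltf_pV2 ?posrE// ltr_nat.
pose D n := X `&` [set x | forall c, C c -> e n <= mdist x c].
have DX n : D n `<=` X by exact: subIsetl.
have ndD m n : (m <= n)%N -> D m `<=` D n.
  rewrite leq_eqVlt => /orP[/eqP -> //|mn] x [Xx Dx]; split => // c /Dx.
  by apply: le_trans; apply/ltW/e_lt.
have DXC : X `&` ~` C `<=` \bigcup_n D n.
  move=> x [Xx nCx]; have : open (~` C) by exact: closed_openC.
  rewrite openE => /(_ _ nCx) /=; rewrite /interior -nbhs_ballE => -[r /= r0 rC].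
  have [n nr] : exists n, e n < r.
    exists (Num.truncn r^-1); rewrite /e -[ltRHS]invrK ltf_pV2 ?posrE ?invr_gt0//.
    by apply: truncnS_gt.
  exists n => //; split => // c Cc; rewrite leNgt; apply/negP => xc.
  by apply: (rC c) => //; rewrite ballEmdist /=; exact: lt_trans nr.
pose r n := mu (D n.+1 `\` D n).
have r_ge0 n : (0 <= r n)%E by exact: outer_measure_ge0.
(* A point of the shell is closer than [e n.+1] to [C], hence at distance at least [e n - e n.+1]
   from [D n]. *)
have Dstep n : (mu (D n) + r n.+1 <= mu (D n.+2))%E.
  apply: le_trans (mu_sep (e := e n - e n.+1) _ _) _.
  - by rewrite subr_gt0 e_lt.
  - move=> a b [_ Da] [[Xb _] nDb].
    have [c Cc bc] : exists2 c, C c & mdist b c < e n.+1.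
      apply: contrapT => H; apply: nDb; split => // c Cc.
      by rewrite leNgt; apply/negP => bc; apply: H; exists c.
    rewrite lerBlDr (le_trans (Da _ Cc))// (le_trans (metric_triangle a b c))//.
    by rewrite lerD2l ltW.
  - by apply: le_outer_measure => x [|[]//]; apply: ndD; rewrite -addn2 leq_addr.
(* [Dstep] telescopes along even and along odd indices; carrying both bounds at once turns this into
   one induction. *)
have sumr n : (\sum_(0 <= k < n) r k.+1 <= mu (D n) + mu (D n.+1))%E.
  elim: n => [|n ih]; first by rewrite big_geq// adde_ge0// outer_measure_ge0.
  rewrite big_nat_recr//= (le_trans (leeD2r _ ih))// addeAC addeC leeD2l//.
have muDX n : (mu (D n) <= mu X)%E by exact/le_outer_measure/DX.
have rsum : (\sum_(k <oo) r k.+1 < +oo)%E.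
  apply: (@le_lt_trans _ _ (mu X + mu X)%E); last by rewrite lte_add_pinfty.
  apply: lime_le; first by apply: is_cvg_nneseries => n _ _; exact: r_ge0.
  by near=> n; rewrite (le_trans (sumr n))// leeD.
have tail0 := nneseries_tail_cvg rsum (fun k _ => r_ge0 k.+1).
have key n : (mu (X `&` C) + mu (X `&` ~` C) <=
    mu X + \sum_(n <= k <oo) r k.+1)%E.
  apply: (@le_trans _ _ (mu (X `&` C) + (mu (D n.+1) + \sum_(n <= k <oo) r k.+1))%E).
    apply: leeD2l.
    apply: (@le_trans _ _ (mu (D n.+1 `|` \bigcup_(k in ~` `I_n) (D k.+2 `\` D k.+1)))%E).
      apply: le_outer_measure => x /DXC[m _ Dmx].
      have [|/= nD] := pselect (D n.+1 x); first by left.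
      have exk : exists m, `[< D m x >] by exists m; exact/asboolP.
      right; case: (ex_minnP exk) => k /asboolP Dkx kmin.
      have nk : (n.+1 < k)%N.
        by rewrite ltnNge; apply/negP => /ndD/(_ x Dkx).
      case: k Dkx kmin nk => // -[//|k] Dkx kmin; rewrite !ltnS => nk.
      exists k; first by apply/negP; rewrite -leqNgt.
      split => // Dk1; have /kmin : `[< D k.+1 x >] by apply/asboolP.
      by rewrite ltnn.
    apply: le_trans (outer_measureU2 _ _ _) _; apply: leeD2l.
    exact: (outer_measure_sigma_subadditive_tail mu n (fun k => D k.+2 `\` D k.+1)).
  rewrite addeA leeD2r//; apply: le_trans (mu_sep (e_gt0 n.+1) _) _.
    by move=> a b [_ Ca] [_ Db]; rewrite metric_sym; exact: Db.
  by apply: le_outer_measure => x [[]//|[]//].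
have XC : (mu X + \sum_(n <= k <oo) r k.+1)%E @[n --> \oo] --> (mu X + 0)%E.
  apply: cvgeD; [|exact: cvg_cst|exact: tail0].
  by rewrite fin_num_adde_defl.
rewrite adde0 in XC; rewrite -(cvg_lim _ XC)//.
apply: lime_ge; first by apply/cvg_ex; exists (mu X).
exact: nearW.
Unshelve. all: by end_near. Qed.

End caratheodory_criterion.

(** * Hausdorff measures *)

(** Used to merge countably many countable covers into one sequence; surjectivity of [f] ensures
    that no covering set is lost. *)
Lemma nneseries_pairing {R : realType} (a : nat -> nat -> \bar R) :
  (forall i j, 0 <= a i j)%E ->
  exists2 f : nat -> nat * nat, (forall p, exists k, f k = p) &
    (\sum_(k <oo) a (f k).1 (f k).2 = \sum_(i <oo) \sum_(j <oo) a i j)%E.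
Proof.
move=> a0; have /card_esym/ppcard_eqP[f] := card_nat2.
exists f; first by move=> p; exists (f^-1%FUN p); rewrite invK ?inE.
pose b p := a p.1 p.2.
have b0 p : (0 <= b p)%E by exact: a0.
transitivity (\esum_(p in setT) b p)%E.
  rewrite -(esum_pred_image b f xpredT) ?[fun=> _]set_true//.
  by rewrite image_eq.
pose J : nat -> set (nat * nat) := fun i => [set (i, j) | j in setT].
rewrite (_ : setT = \bigcup_k J k); last first.
  by rewrite predeqE => -[i j]; split => // _; exists i => //; exists j.
rewrite esum_bigcupT//=; last first.
  apply/trivIsetP => i j _ _ ij.
  rewrite predeqE => -[n m] /=; split => //= -[] [_] _ [<-{n} _].
  by move=> [m' _] [] /esym/eqP; rewrite (negbTE ij).
rewrite -(image_id [set: nat]) -fun_true esum_pred_image//; last first.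
  by move=> n _; exact: esum_ge0.
apply: eq_eseriesr => /= j _.
rewrite -(esum_pred_image b (pair j) predT)//=; last first.
  by move=> ? ? _ _; exact: (@can_inj _ _ _ snd).
by congr esum; rewrite predeqE => -[u v]; split; move=> [i _ <-]; exists i.
Qed.

Section hausdorff_theory.
Context {R : realType} {Y : metricType R}.
Implicit Types (U E A B : set Y).

Lemma diam_ub U x y : U x -> U y -> ((mdist x y)%:E <= diam U)%E.
Proof. by move=> Ux Uy; apply: ereal_sup_ubound; exists (x, y). Qed.

Lemma diam_le U (d : \bar R) :
  (forall x y, U x -> U y -> ((mdist x y)%:E <= d)%E) -> (diam U <= d)%E.
Proof. by move=> H; apply: ge_ereal_sup => _ [[x y] [/= Ux Uy] <-]; exact: H. Qed.

Lemma le_diam U V : U `<=` V -> (diam U <= diam V)%E.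
Proof. by move=> UV; apply: diam_le => x y /UV Vx /UV Vy; exact: diam_ub. Qed.

Lemma diam0 : diam (@set0 Y) = -oo%E.
Proof. by rewrite /diam set0X image_set0 ereal_sup0. Qed.

Lemma diam_ge0 U : U !=set0 -> (0 <= diam U)%E.
Proof. by move=> [x Ux]; rewrite (le_trans _ (diam_ub Ux Ux))// lee_fin mdist_ge0. Qed.

Lemma fine_diam_ge0 U : 0 <= fine (diam U).
Proof.
have [->|/set0P/diam_ge0/fine_ge0//] := eqVneq U set0.
by rewrite diam0.
Qed.

Lemma diam_closure U : diam (closure U) = diam U.
Proof.
apply/eqP; rewrite eq_le (le_diam (@subset_closure _ U)) andbT.
apply: diam_le => x y cx cy.
apply/lee_addgt0Pr => e e0; have e2 : 0 < e / 2 by rewrite divr_gt0.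
have [x' [Ux']] := cx _ (nbhsx_ballx x _ e2); rewrite ballEmdist /= => xx'.
have [y' [Uy']] := cy _ (nbhsx_ballx y _ e2); rewrite ballEmdist /= => yy'.
apply: le_trans (leeD2r _ (diam_ub Ux' Uy')); rewrite -EFinD lee_fin.
have := metric_triangle x x' y; have := metric_triangle x' y' y.
rewrite (metric_sym y' y); lra.
Qed.

Variable h : R -> R.
Hypothesis h_ge0 : forall t : R, 0 <= t -> 0 <= h t.
Hypothesis h_nd : forall s t : R, 0 <= s -> s <= t -> h s <= h t.

Lemma gauge_ge0 U : (0 <= hausdorff_gauge h U)%E.
Proof.
rewrite /hausdorff_gauge; case: ifP => // _.
by rewrite lee_fin h_ge0// fine_diam_ge0.
Qed.

Lemma gauge0 : hausdorff_gauge h (@set0 Y) = 0%E.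
Proof. by rewrite /hausdorff_gauge eqxx. Qed.

Lemma gauge_le U (d : R) : 0 <= d -> (diam U <= d%:E)%E ->
  (hausdorff_gauge h U <= (h d)%:E)%E.
Proof.
move=> d0 Ud; rewrite /hausdorff_gauge; case: ifP => [_|/negbT/set0P U0].
  by rewrite lee_fin h_ge0.
rewrite lee_fin h_nd ?fine_diam_ge0// -lee_fin fineK//.
by rewrite ge0_fin_numE ?diam_ge0// (le_lt_trans Ud)// ltry.
Qed.

(** Lets a cover be replaced by closed sets at no cost. *)
Lemma gauge_closure U : hausdorff_gauge h (closure U) = hausdorff_gauge h U.
Proof.
rewrite /hausdorff_gauge diam_closure.
have [->|/set0P[x Ux]] := eqVneq U set0; first by rewrite closure0 eqxx.
by case: ifPn => // /eqP cU; have := subset_closure Ux; rewrite cU.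
Qed.

Lemma content_ge0 d E : (0 <= hausdorff_content h d E)%E.
Proof.
apply: le_ereal_inf_tmp => _ [U _ <-]; apply: nneseries_ge0 => n _ _.
exact: gauge_ge0.
Qed.

Lemma le_content d A B : A `<=` B ->
  (hausdorff_content h d A <= hausdorff_content h d B)%E.
Proof.
move=> AB; apply: ereal_inf_le_tmp => _ [U [Ud BU] <-]; exists U => //.
by split => //; exact: subset_trans AB BU.
Qed.

Lemma content_anti d d' E : d <= d' ->
  (hausdorff_content h d' E <= hausdorff_content h d E)%E.
Proof.
move=> dd'; apply: ereal_inf_le_tmp => _ [U [Ud EU] <-]; exists U => //.
by split => // i; rewrite (le_trans (Ud i))// lee_fin.
Qed.

Lemma content_le_cover d (U : nat -> set Y) E :
  (forall i, (diam (U i) <= d%:E)%E) -> E `<=` \bigcup_i U i ->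
  (hausdorff_content h d E <= \sum_(i <oo) hausdorff_gauge h (U i))%E.
Proof. by move=> Ud EU; apply: ereal_inf_lbound; exists U. Qed.

Lemma content_lt_cover d E (r : \bar R) : (hausdorff_content h d E < r)%E ->
  exists U : nat -> set Y, [/\ forall i, (diam (U i) <= d%:E)%E,
    E `<=` \bigcup_i U i & (\sum_(i <oo) hausdorff_gauge h (U i) < r)%E].
Proof. by move=> /ereal_inf_lt[_ [U [Ud EU] <-] Ur]; exists U. Qed.

Lemma content0 d : hausdorff_content h d (@set0 Y) = 0%E.
Proof.
apply/eqP; rewrite eq_le content_ge0 andbT.
apply: le_trans (content_le_cover (U := fun=> set0) _ _) _ => //.
  by move=> _; rewrite diam0 leNye.
by rewrite eseries0// => i _ _; rewrite gauge0.
Qed.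

Lemma content_sigma_subadditive d : sigma_subadditive (@hausdorff_content R Y h d).
Proof.
move=> A; have [[i ioo]|] := pselect (exists i, hausdorff_content h d (A i) = +oo%E).
  rewrite (eseries_pinfty _ _ ioo) ?leey// => n _.
  by rewrite -ltNye (lt_le_trans _ (content_ge0 _ _)).
rewrite -forallNE => Aoo; apply/lee_addgt0Pr => e e0.
rewrite (le_trans _ (epsilon_trick xpredT _ (ltW e0)))//; last first.
  by move=> n; exact: content_ge0.
have cov n : exists U : nat -> set Y, [/\ forall i, (diam (U i) <= d%:E)%E,
    A n `<=` \bigcup_i U i & (\sum_(i <oo) hausdorff_gauge h (U i) <
      hausdorff_content h d (A n) + (e / (2 ^ n.+1)%:R)%:E)%E].
  apply: content_lt_cover; rewrite lteDl ?lte_fin ?divr_gt0//.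
  by rewrite ge0_fin_numE ?content_ge0// ltey; exact/eqP.
have [G PG] := choice cov.
have [p psurj psum] := @nneseries_pairing R (fun i j => hausdorff_gauge h (G i j))
  (fun i j => gauge_ge0 _).
apply: (@le_trans _ _ (\sum_(i <oo) \sum_(j <oo) hausdorff_gauge h (G i j))%E).
  rewrite -psum; apply: content_le_cover; first by move=> i; have [+ _ _] := PG (p i).1; exact.
  move=> x [n _ Anx]; have [_ /(_ _ Anx)[m _ Gx] _] := PG n.
  by have [k kE] := psurj (n, m); exists k => //; rewrite kE.
apply: lee_nneseries => [i _ _|i _]; first by apply: nneseries_ge0 => *; exact: gauge_ge0.
by apply/ltW; have [] := PG i.
Qed.

Lemma content_le_measure d E : 0 < d ->
  (hausdorff_content h d E <= hausdorff_measure h E)%E.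
Proof. by move=> d0; apply: ereal_sup_ubound; exists d. Qed.

Lemma measure_le E (M : \bar R) :
  (forall d, 0 < d -> (hausdorff_content h d E <= M)%E) ->
  (hausdorff_measure h E <= M)%E.
Proof. by move=> H; apply: ge_ereal_sup => _ [d d0 <-]; exact: H. Qed.

Lemma hausdorff_measure_ge0 E : (0 <= hausdorff_measure h E)%E.
Proof. exact: le_trans (content_ge0 1 _) (content_le_measure _ _). Qed.

Lemma hausdorff_measure0 : hausdorff_measure h (@set0 Y) = 0%E.
Proof.
apply/eqP; rewrite eq_le hausdorff_measure_ge0 andbT.
by apply: measure_le => d _; rewrite content0.
Qed.

Lemma le_hausdorff_measure :
  {homo @hausdorff_measure R Y h : A B / A `<=` B >-> (A <= B)%E}.
Proof.
move=> A B AB; apply: measure_le => d d0.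
exact: le_trans (le_content _ AB) (content_le_measure _ _).
Qed.

Lemma hausdorff_measure_sigma_subadditive :
  sigma_subadditive (@hausdorff_measure R Y h).
Proof.
move=> A; apply: measure_le => d d0.
apply: le_trans (content_sigma_subadditive _ _) _.
apply: lee_nneseries => [i _ _|i _]; first exact: content_ge0.
exact: content_le_measure.
Qed.

Let hausdorff_outer := HB.pack_for (outer_measure R Y) (@hausdorff_measure R Y h)
  (isOuterMeasure.Build R Y _ hausdorff_measure0 hausdorff_measure_ge0
    le_hausdorff_measure hausdorff_measure_sigma_subadditive).

(** A set of diameter at most [e / 2] cannot meet both [A] and [B], so a fine cover of the union
    splits into disjoint subfamilies covering [A] and [B]. *)
Lemma hausdorff_measure_sep A B (e : R) : 0 < e ->
  (forall a b, A a -> B b -> e <= mdist a b) ->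
  (hausdorff_measure h A + hausdorff_measure h B <= hausdorff_measure h (A `|` B))%E.
Proof.
move=> e0 AB.
have [->|ABoo] := eqVneq (hausdorff_measure h (A `|` B)) +oo%E; first exact: leey.
have fin C : C `<=` A `|` B -> hausdorff_measure h C \is a fin_num.
  move=> CAB; rewrite ge0_fin_numE ?hausdorff_measure_ge0// ltey.
  apply: contra ABoo => /eqP Coo; rewrite -leye_eq -Coo.
  exact: le_hausdorff_measure.
have key (d d' : R) : 0 < d -> 0 < d' -> (hausdorff_content h d A +
    hausdorff_content h d' B <= hausdorff_measure h (A `|` B))%E.
  move=> d0 d'0; pose m := Num.min (e / 2) (Num.min d d').
  have m0 : 0 < m by rewrite !lt_min d0 d'0 divr_gt0.
  apply: (@le_trans _ _ (hausdorff_content h m A + hausdorff_content h m B)%E).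
    by apply: leeD; apply: content_anti; rewrite !ge_min lexx ?orbT.
  apply: le_trans (content_le_measure _ m0).
  apply: le_ereal_inf_tmp => _ [U [Um ABU] <-].
  pose sel C i := if U i `&` C == set0 then set0 else U i.
  have seldiam C i : (diam (sel C i) <= m%:E)%E.
    by rewrite /sel; case: ifP => _; [rewrite diam0 leNye|exact: Um].
  have selcov C : C `<=` A `|` B -> C `<=` \bigcup_i sel C i.
    move=> CAB x Cx; have [i _ Uix] := ABU _ (CAB _ Cx); exists i => //.
    by rewrite /sel ifF//; apply/negbTE/set0P; exists x.
  apply: le_trans (leeD (content_le_cover (seldiam A) (selcov A (@subsetUl _ _ _)))
    (content_le_cover (seldiam B) (selcov B (@subsetUr _ _ _)))) _.
  rewrite -nneseriesD; [|by move=> *; exact: gauge_ge0|by move=> *; exact: gauge_ge0].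
  apply: lee_nneseries => [i _ _|i _]; first by apply: adde_ge0; exact: gauge_ge0.
  rewrite /sel; case: ifPn => [_|UA]; case: ifPn => [_|UB];
    rewrite ?gauge0 ?adde0 ?add0e ?lexx ?gauge_ge0//.
  move: UA UB => /set0P[a [Ua Aa]] /set0P[b [Ub Bb]].
  have := le_trans (diam_ub Ua Ub) (Um i); rewrite lee_fin => abm.
  have := AB _ _ Aa Bb => /le_trans/(_ abm); rewrite /m !le_min.
  by move=> /andP[e2 _]; exfalso; lra.
have finB : hausdorff_measure h B \is a fin_num by apply: fin; exact: subsetUr.
(* The suprema over [d] and [d'] are taken one after the other; finiteness lets the other term
   change sides. *)
rewrite -leeBrDr//; apply: measure_le => d d0; rewrite leeBrDr//.
have cfin : hausdorff_content h d A \is a fin_num.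
  rewrite ge0_fin_numE ?content_ge0// (le_lt_trans (content_le_measure _ d0))//.
  by rewrite -ge0_fin_numE ?hausdorff_measure_ge0// fin//; exact: subsetUl.
rewrite addeC -leeBrDr//; apply: measure_le => d' d'0.
by rewrite leeBrDr// addeC; exact: key.
Qed.

Lemma hausdorff_closed_caratheodory (C : set Y) : closed C ->
  (hausdorff_measure h).-caratheodory C.
Proof. exact: (@caratheodory_closed _ _ hausdorff_outer hausdorff_measure_sep). Qed.

(** Sigma-finiteness asks for measurable pieces, whereas density bounds give arbitrary sets. The
    hull intersects closed covers of mesh [d n]; finiteness is the only goal, so each may exceed the
    measure of [E] by 1. *)
Lemma hausdorff_measurable_hull E : (hausdorff_measure h E < +oo)%E ->
  exists G, [/\ E `<=` G, (hausdorff_measure h).-caratheodory G &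
    (hausdorff_measure h G < +oo)%E].
Proof.
move=> Eoo.
have Efin : hausdorff_measure h E \is a fin_num.
  by rewrite ge0_fin_numE ?hausdorff_measure_ge0.
pose d n : R := n.+1%:R^-1.
have d0 n : 0 < d n by rewrite invr_gt0.
have cov n : exists U : nat -> set Y, [/\ forall i, (diam (U i) <= (d n)%:E)%E,
    E `<=` \bigcup_i U i & (\sum_(i <oo) hausdorff_gauge h (U i) <
      hausdorff_measure h E + 1)%E].
  apply: content_lt_cover; apply: le_lt_trans (content_le_measure _ (d0 n)) _.
  by rewrite lteDl// lte01.
have [U PU] := choice cov.
exists (\bigcap_n \bigcup_i closure (U n i)); split.
- move=> x Ex n _; have [_ /(_ _ Ex)[i _ Ux] _] := PU n.
  by exists i => //; exact: subset_closure.
- apply: (caratheodory_measurable_bigcap (mu := hausdorff_outer)) => n.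
  apply: caratheodory_measurable_bigcup => i.
  by apply: hausdorff_closed_caratheodory; exact: closed_closure.
- apply: (@le_lt_trans _ _ (hausdorff_measure h E + 1)%E); last first.
    by rewrite lte_add_pinfty// ltry.
  apply: measure_le => e e0; pose n := Num.truncn e^-1.
  have dn : d n <= e.
    rewrite /d -[leRHS]invrK lef_pV2 ?posrE ?invr_gt0//.
    by apply/ltW; exact: truncnS_gt.
  apply: le_trans (content_anti _ dn) _; have [Ud _ Us] := PU n.
  apply: le_trans (content_le_cover (U := fun i => closure (U n i)) _ _) _.
  + by move=> i; rewrite diam_closure; exact: Ud.
  + by move=> x /(_ n I).
  + by under eq_eseriesr do rewrite gauge_closure; exact: ltW.
Qed.

Lemma hausdorff_sigma_finite (E : nat -> set Y) :
  (forall n, (hausdorff_measure h (E n) < +oo)%E) -> \bigcup_n E n = setT ->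
  sigma_finite_set (hausdorff_measure h) [set: Y].
Proof.
move=> Eoo ET; have [G PG] := choice (fun n => hausdorff_measurable_hull (Eoo n)).
exists G; split => [n|]; first by have [] := PG n.
apply/seteqP; split => // x _; have : (\bigcup_n E n) x by rewrite ET.
by move=> [n _ Ex]; exists n => //; have [+ _ _] := PG n; exact.
Qed.

End hausdorff_theory.

(** * Essential separability *)

Lemma countable_setU {T} (A B : set T) :
  countable A -> countable B -> countable (A `|` B).
Proof.
by move=> cA cB; rewrite -bigcup2E; apply: bigcup_countable => // -[|[|n]] _ /=.
Qed.

(* Ulam's matrix: along a well-order whose initial segments are countable, [A n b]
   collects the [a] above [b] whose predecessors are numbered so that [b] gets
   number [n]. *)
Lemma uncountable_split (T : eqType) (I : set T) : ~ countable I ->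
  exists (B : set T) (J : T -> set T), [/\ ~ countable B,
    forall b, B b -> J b `<=` I /\ ~ countable (J b) & trivIset B J].
Proof.
move=> ncI; have [r rwo] := well_ordering_principle T.
have minP (A : set T) : A !=set0 -> exists2 z, A z & forall x, A x -> r z x.
  move=> [x Ax]; have [|z [[zA zmin] _]] := rwo (mem A).
    by exists x; rewrite inE.
  by exists z; [rewrite inE in zA|move=> t At; apply: zmin; rewrite inE].
have r_total x y : r x y \/ r y x.
  have [|z /= [] -> zmin] := minP [set t | t = x \/ t = y].
  - by exists x; left.
  - by left; apply: zmin; right.
  - by right; apply: zmin; left.
have r_refl x : r x x by case: (r_total x x).
have r_anti x y : r x y -> r y x -> x = y.
  move=> xy yx; have [|z [_ zu]] := rwo (pred2 x y); first by exists x; rewrite inE eqxx.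
  rewrite -(zu x); last first.
    by split; rewrite ?inE ?eqxx// => t; rewrite inE => /orP[]/eqP ->.
  apply: zu; split; first by rewrite inE eqxx orbT.
  by move=> t; rewrite inE => /orP[]/eqP ->.
pose seg (A : set T) x := A `&` [set y | r y x /\ y <> x].
(* The least point with an uncountable initial segment, if there is one, cuts off an uncountable set
   all of whose own initial segments are countable. *)
have [I0 [I0I ncI0 segc]] : exists I0, [/\ I0 `<=` I, ~ countable I0 &
    forall x, I0 x -> countable (seg I0 x)].
  have [[x xnc]|nx] := pselect (exists x, ~ countable (seg I x)); last first.
    exists I; split => // x _; apply: contrapT => xnc; apply: nx; by exists x.
  have [|z znc zmin] := minP [set x | ~ countable (seg I x)]; first by exists x.
  exists (seg I z); split => //; first exact: subIsetl.
  move=> y [Iy [yz ynz]]; apply: contrapT => nc.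
  apply: ynz; apply: r_anti => //; apply: zmin => c; apply: nc.
  by apply: sub_countable c; apply: subset_card_le => t [[It _] ?]; split.
have inj x : exists g : T -> nat, I0 x -> {in seg I0 x &, injective g}.
  have [I0x|nI0x] := pselect (I0 x); last by exists (fun=> 0%N).
  by have /countable_injP[g gi] := segc _ I0x; exists g.
have [g gP] := choice inj.
pose A n b := [set a | [/\ I0 a, r b a, b <> a & g a b = n]].
have An b : exists n, I0 b -> ~ countable (A n b).
  apply: contrapT => H; apply: ncI0.
  have I0b : I0 b by apply: contrapT => nb; apply: H; exists 0%N.
  have : countable (seg I0 b `|` [set b] `|` \bigcup_n A n b).
    apply: countable_setU; first by apply: countable_setU; [exact: segc|exact: countable1].
    apply: bigcup_countable => // n _; apply: contrapT => nc; apply: H.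
    by exists n.
  apply: sub_countable; apply: subset_card_le => a I0a.
  have [->|/eqP ab] := eqVneq a b; first by left; right.
  have [?|?] := r_total a b; first by left; left.
  by right; exists (g a b) => //; split => //; exact/nesym.
have [n nP] := choice An.
(* Each [b] has an uncountable [A n b] for some [n]; by the pigeonhole principle one value [m]
   serves uncountably many [b]. *)
have [m mP] : exists m, ~ countable (I0 `&` [set b | n b = m]).
  apply: contrapT => H; apply: ncI0.
  have : countable (\bigcup_m (I0 `&` [set b | n b = m])).
    by apply: bigcup_countable => // m _; apply: contrapT => nc; apply: H; exists m.
  by apply: sub_countable; apply: subset_card_le => b I0b; exists (n b).
exists (I0 `&` [set b | n b = m]), (A m); split => //.
  move=> b [I0b nb]; split; first by move=> a [/I0I].
  by rewrite -nb; exact: nP.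
(* A common element [a] gives [b] and [c] the same number [m], and [g a] is injective on the
   predecessors of [a]. *)
move=> b c [I0b _] [I0c _] [a [[I0a ba nba gb] [_ ca nca gc]]].
by apply: (gP _ I0a); rewrite ?inE; [split..|rewrite gb gc].
Qed.

(** Every index lies in some [C j k], whose sets have measure above [1 / (k + 1)] within [F j].
    Additivity and finiteness of [mu (F j)] bound the number of such indices. *)
Lemma positive_disjoint_countable {R : realType} {X T : Type}
    (mu : {outer_measure set X -> \bar R}) (B : set T) (J : T -> set X) :
  sigma_finite_set mu [set: X] -> trivIset B J ->
  (forall b, B b -> mu.-caratheodory (J b) /\ (0 < mu (J b))%E) ->
  countable B.
Proof.
move=> [F [Ffin FT]] tJ JP.
pose C j k := B `&` [set b | (k.+1%:R^-1%:E < mu (F j `&` J b))%E].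
have BC : B `<=` \bigcup_j \bigcup_k C j k.
  move=> b Bb; have [_ Jb0] := JP _ Bb.
  have [j jP] : exists j, (0 < mu (F j `&` J b))%E.
    apply: contrapT => H; move: Jb0; apply/negP; rewrite -leNgt.
    have <- : mu (\bigcup_j (F j `&` J b)) = 0%E.
      apply: outer_measure_bigcup_null => j; apply/eqP.
      rewrite eq_le outer_measure_ge0 andbT leNgt; apply/negP => ?.
      by apply: H; exists j.
    by rewrite -setI_bigcupl -FT setTI.
  have [k kP] : exists k, (k.+1%:R^-1%:E < mu (F j `&` J b))%E.
    move: jP; case: (mu _) => [r| |//]; last by exists 0%N; rewrite ltry.
    rewrite lte_fin => r0; exists (Num.truncn r^-1); rewrite lte_fin.
    by rewrite -[ltRHS]invrK ltf_pV2 ?posrE ?invr_gt0//; exact: truncnS_gt.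
  by exists j => //; exists k.
suff Cf j k : finite_set (C j k).
  have : countable (\bigcup_j \bigcup_k C j k).
    apply: bigcup_countable => // j _; apply: bigcup_countable => // k _.
    exact: finite_set_countable.
  by apply: sub_countable; exact: subset_card_le.
apply: contrapT => /infiniteP/card_leP[g].
pose s i := val (g (SigSub (mem_set (I : [set: nat] i)))).
have sC i : C j k (s i) by exact: set_valP.
have s_inj i i' : s i = s i' -> i = i'.
  by move=> /val_inj/(inj (in_setT _) (in_setT _))[].
have sB i : B (s i) by have [] := sC i.
have [mF Foo] := Ffin j.
have tS : trivIset setT (J \o s).
  by move=> i i' _ _ /(tJ _ _ (sB i) (sB i'))/s_inj.
have bound n : ((n%:R * k.+1%:R^-1 : R)%:E <= mu (F j))%E.
  have := caratheodory_additive (mu := mu) (A := J \o s) (fun i => (JP _ (sB i)).1) tS n (F j).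
  set M := mu _ => ME; apply: (@le_trans _ _ M); last by apply: le_outer_measure; exact: subIsetl.
  rewrite ME; apply: (@le_trans _ _ (\sum_(i < n) k.+1%:R^-1%:E)%E).
    by rewrite sumEFin sumr_const card_ord mulr_natl.
  by apply: lee_sum => i _; have [_ /ltW] := sC i.
have Ffn : mu (F j) \is a fin_num by rewrite ge0_fin_numE// outer_measure_ge0.
have := bound (Num.truncn (fine (mu (F j)) * k.+1%:R)).+1.
rewrite -(fineK Ffn) lee_fin ler_pdivrMr// leNgt => /negP; apply.
exact: truncnS_gt.
Qed.

Lemma mball_open {R : realType} {Y : metricType R} (y : Y) (r : R) :
  open (ball y r).
Proof.
rewrite openE => z; rewrite ballEmdist /= => yz; rewrite /interior -nbhs_ballE.
exists (r - mdist y z) => /=; first by rewrite subr_gt0.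
move=> t; rewrite !ballEmdist /= => zt.
have := metric_triangle y z t; lra.
Qed.

Section separability.
Context {R : realType} {X : Type} {Y : metricType R}.
Variables (mu : {outer_measure set X -> \bar R}) (f : X -> Y) (h : R -> R).
Hypothesis mu_sf : sigma_finite_set mu [set: X].
Hypothesis f_meas : outer_measurable_fun mu f.
Hypothesis f_surj : forall y : Y, exists x : X, f x = y.
Hypothesis null_image : forall N : set X, mu N = 0%E ->
  hausdorff_measure h (f @` N) = 0%E.

Lemma disjoint_balls_countable (S : set Y) (e : R) : 0 < e ->
  trivIset S (fun y => ball y e) -> countable S.
Proof.
move=> e0 tS; apply: contrapT => /uncountable_split[B [J [ncB JP tJ]]].
apply: ncB; pose O b := \bigcup_(y in J b) ball y e.
apply: (positive_disjoint_countable (J := fun b => f @^-1` O b) mu_sf).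
  move=> b c Bb Bc [x [[y Jy yx] [z Jz zx]]].
  have [[JbS _] [JcS _]] := (JP _ Bb, JP _ Bc).
  apply: tJ => //; exists y; split => //.
  by rewrite (tS y z (JbS _ Jy) (JcS _ Jz))//; exists (f x).
move=> b Bb; split.
  by apply: f_meas; apply: bigcup_open => y _; exact: mball_open.
rewrite lt_neqAle outer_measure_ge0 andbT; apply/eqP => /esym/null_image H0.
have [JbS ncJ] := JP _ Bb; apply: ncJ.
have e2 : 0 < e / 2 by rewrite divr_gt0.
(* A null image has a countable cover by sets of diameter at most [e / 2]. Each contains at most one
   centre, because the balls of radius [e] are disjoint, so [J b] would be countable. *)
have : (hausdorff_content h (e / 2) (f @` (f @^-1` O b)) < 1)%E.
  by rewrite (le_lt_trans (content_le_measure _ _ e2))// H0 lte01.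
move=> /content_lt_cover[U [Ud Ucov _]].
have : countable (\bigcup_i (J b `&` U i)).
  apply: bigcup_countable => // i _.
  have [->|/set0P[y [Jy Uy]]] := eqVneq (J b `&` U i) set0; first exact: countable0.
  apply: sub_countable (countable1 y); apply: subset_card_le => z [Jz Uz].
  have := le_trans (diam_ub Uy Uz) (Ud i); rewrite lee_fin => yz /=.
  apply/esym/tS; [exact: JbS|exact: JbS|exists z; split].
    by rewrite ballEmdist /=; lra.
  exact: ballxx.
apply: sub_countable; apply: subset_card_le => y Jy.
have [x fxy] := f_surj y.
have [|i _ Uy] := Ucov y; last by exists i.
by exists x => //; exists y => //; rewrite /= fxy; exact: ballxx.
Qed.

(** The centres of maximal disjoint families of balls of radius [e n] are dense: by maximality the
    ball around any [y] meets a ball of the family, so a centre lies within [2 * e n]. *)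
Lemma separable_codomain : exists D : set Y, countable D /\
  forall (y : Y) (e : R), 0 < e -> exists2 x, D x & mdist x y < e.
Proof.
pose e n : R := n.+1%:R^-1.
have e0 n : 0 < e n by rewrite invr_gt0.
have ex n : exists S : set Y, maximal_disjoint_subcollection
    (fun y => ball y (e n)) S [set: Y].
  by have [S ?] := ex_maximal_disjoint_subcollection (fun y : Y => ball y (e n)) setT;
    exists S.
have [S SP] := choice ex.
exists (\bigcup_n S n); split.
  by apply: bigcup_countable => // n _; apply: (disjoint_balls_countable (e0 n)); have [] := SP n.
move=> y r r0; pose n := Num.truncn (2 / r).
have nr : e n + e n < r.
  have : e n < r / 2.
    rewrite /e -[ltRHS]invrK ltf_pV2 ?posrE ?invr_gt0 ?divr_gt0//.
    by rewrite invf_div; exact: truncnS_gt.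
  lra.
have [_ tS maxS] := SP n.
have [x [Sx [z [xz yz]]]] : exists x, S n x /\ ball x (e n) `&` ball y (e n) !=set0.
  have [Sy|nSy] := pselect (S n y).
    by exists y; split => //; exists y; split; exact: ballxx.
  apply: contrapT => H; apply: (maxS (S n `|` [set y])) => //.
    split; first exact: subsetUl.
    by move=> /(_ y) yS; apply: nSy; apply: yS; right.
  move=> a b [Sa|->] [Sb|->] ab //; first exact: tS.
  - by exfalso; apply: H; exists a.
  - by exfalso; apply: H; exists b; split => //; rewrite setIC.
exists x; first by exists n.
move: xz yz; rewrite !ballEmdist /= => xz yz.
have := metric_triangle x z y; rewrite (metric_sym z y); lra.
Qed.

End separability.

(** * Inner regularity and Lusin's theorem *)

Lemma nat_pair_surj : exists p : nat -> nat * nat, forall q, exists k, p k = q.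
Proof.
have /card_esym/ppcard_eqP[f] := card_nat2.
by exists f => q; exists (f^-1%FUN q); rewrite invK ?inE.
Qed.

(** Continuity of the restriction to [L], expressed by open sets of [X] so that no subspace type is
    involved. *)
Definition relatively_continuous {X Y : topologicalType} (L : set X) (f : X -> Y) :=
  forall O : set Y, open O ->
    exists2 W : set X, open W & L `&` f @^-1` O = L `&` W.

Section regular_spaces.
Context {X : topologicalType}.
Hypothesis X_reg : regular_T1_space X.

Lemma regular_T1_hausdorff : hausdorff_space X.
Proof.
rewrite open_hausdorff => x y xy.
have [|U [V [oU oV Ux yV UV]]] := X_reg.2 x [set y] (X_reg.1 y).
  by move=> /= xE; rewrite xE eqxx in xy.
exists (U, V); first by split; rewrite inE//; exact: yV.
by split => //; apply/eqP.
Qed.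

(** By regularity every point of [O] has a basic neighbourhood whose closure stays in [O]. [D n] is
    the closure of the basic set numbered [n] if it lies in [O], and empty otherwise; finite unions
    make the sequence increase. *)
Lemma open_closed_exhaustion (O : set X) : @second_countable X -> open O ->
  exists C : nat -> set X, [/\ forall n, closed (C n),
    nondecreasing_seq C & O = \bigcup_n C n].
Proof.
move=> [B cB [_ Bbase]] oO; have /countable_injP[g g_inj] := cB.
pose D n := [set x | exists V, [/\ B V, g V = n, closure V `<=` O & closure V x]].
have Dcl n : closed (D n).
  have [[V [BV gV VO]]|nV] := pselect (exists V, [/\ B V, g V = n & closure V `<=` O]).
    rewrite (_ : D n = closure V); first exact: closed_closure.
    apply/seteqP; split => [x [V' [BV' gV' _ V'x]]|x Vx]; last by exists V.
    by rewrite (_ : V = V')//; apply: g_inj; rewrite ?inE// gV gV'.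
  rewrite (_ : D n = set0); first exact: closed0.
  by apply/seteqP; split => // x [V [? ? ? _]]; apply: nV; exists V.
exists (fun n => \bigcup_(i in `I_n.+1) D i); split.
- by move=> n; apply: closed_bigcup => //; exact: finite_II.
- move=> m n mn; apply/subsetPset => x [i /= im Dx]; exists i => //=.
  by rewrite ltnS; exact: leq_trans mn.
- apply/seteqP; split => [x Ox|x [n _ [i _ [V [_ _ VO Vx]]]]]; last exact: VO.
  have [||U [V [oU oV Ux OV UV]]] := X_reg.2 x (~` O); [exact: open_closedC|by apply|].
  have [W [BW Wx] WU] := Bbase x U (open_nbhs_nbhs (conj oU Ux)).
  have WO : closure W `<=` O.
    move=> z /(closureS WU) clUz; apply: contrapT => nOz.
    have [t [Ut Vt]] := clUz _ (open_nbhs_nbhs (conj oV (OV _ nOz))).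
    by have : (U `&` V) t by []; rewrite UV.
  exists (g W) => //; exists (g W) => //=; exists W; split => //.
  exact: subset_closure.
Qed.

Context {R : realType} (mu : {outer_measure set X -> \bar R}).
Hypothesis X_sc : @second_countable X.
Hypothesis mu_borel : borel_outer mu.
Hypothesis mu_Gdelta : Gdelta_regular mu.

Lemma open_caratheodory (O : set X) : open O -> mu.-caratheodory O.
Proof. by move=> oO; apply: mu_borel; exact: sub_sigma_algebra. Qed.

Lemma closed_caratheodory (C : set X) : closed C -> mu.-caratheodory C.
Proof.
move=> cC; rewrite -(setCK C); apply: caratheodory_measurable_setC.
by apply: open_caratheodory; exact: closed_openC.
Qed.

Lemma Gdelta_inner_closed (G A : set X) (e : R) : Gdelta G -> A `<=` G ->
  (mu A < +oo)%E -> 0 < e ->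
  exists C, [/\ closed C, C `<=` G & (mu (A `\` C) <= e%:E)%E].
Proof.
move=> [ O oO GE] AG Aoo e0.
have ex n : exists C, [/\ closed C, C `<=` O n & (mu (A `\` C) <= (e / (2 ^ n.+1)%:R)%:E)%E].
  have [C [cC ndC OC]] := open_closed_exhaustion X_sc (oO n).
  have e'0 : 0 < e / (2 ^ n.+1)%:R by rewrite divr_gt0// ltr0n expn_gt0.
  have [||m mP] := caratheodory_setD_lt Aoo _ ndC _ e'0.
  - by move=> m; exact/closed_caratheodory/cC.
  - by move=> x /AG; rewrite GE => /(_ n I); rewrite OC.
  - exists (C m); split => //; last exact: ltW.
    by rewrite OC => x Cx; exists m.
have [C CP] := choice ex.
exists (\bigcap_n C n); split.
- by apply: closed_bigI => n _; have [] := CP n.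
- by rewrite GE => x Cx n _; have [_ + _] := CP n; apply; exact: Cx.
- rewrite setDE setC_bigcap setI_bigcupr.
  by apply: outer_measure_bigcup_geo => [|n]; [exact: ltW|have [] := CP n].
Qed.

(** A closed subset of the hull [G] may leak into [G] minus [E], which is null. The complement of a
    null G-delta hull [G'] of this leak is an increasing union of closed sets [D n], so intersecting
    with a late [D n] removes the leak at small cost. *)
Lemma inner_closed (E : set X) (e : R) : mu.-caratheodory E -> (mu E < +oo)%E ->
  0 < e -> exists C, [/\ closed C, C `<=` E & (mu (E `\` C) <= e%:E)%E].
Proof.
move=> mE Eoo e0; have e2 : 0 < e / 2 by rewrite divr_gt0.
have [G [Gd EG GE]] := mu_Gdelta E.
have GE0 : mu (G `\` E) = 0%E.
  have := mE G; rewrite (setIidr EG) GE -setDE => H.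
  have Efin : mu E \is a fin_num by rewrite ge0_fin_numE// outer_measure_ge0.
  by rewrite -(addeK (mu (G `\` E)) Efin) (addeC (mu (G `\` E))) -H subee.
have [G' [[ O oO G'E] GEG' G'0]] := mu_Gdelta (G `\` E); rewrite GE0 in G'0.
have [C1 [cC1 C1G C1e]] := Gdelta_inner_closed Gd EG Eoo e2.
pose D n := \bigcup_(i in `I_n.+1) ~` O i.
have Dcl n : closed (D n).
  by apply: closed_bigcup => [|i _]; [exact: finite_II|exact: open_closedC].
have [|||||n Dn] := @caratheodory_setD_lt _ _ mu (E `\` G') D (e / 2).
- by apply: le_lt_trans Eoo; apply: le_outer_measure; exact: subDsetl.
- by move=> n; exact: closed_caratheodory.
- move=> m n mn; apply/subsetPset => x [i /= im Dx]; exists i => //=.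
  by rewrite ltnS; exact: leq_trans mn.
- move=> x [Ex]; rewrite G'E => /existsNP[i /not_implyP[_ Ox]].
  by exists i => //; exists i => //=.
- by [].
exists (C1 `&` D n); split; first exact: closedI.
  move=> x [/C1G Gx [i _ nOx]]; apply: contrapT => nEx.
  by have := GEG' x (conj Gx nEx); rewrite G'E => /(_ i I).
apply: (@le_trans _ _ (mu ((E `\` C1) `|` ((E `\` G') `\` D n) `|` G'))).
  apply: le_outer_measure => x [Ex /not_andP[nC|nD]]; first by left; left.
  have [?|?] := pselect (G' x); first by right.
  by left; right.
apply: le_trans (outer_measureU2 _ _ _) _; rewrite G'0 adde0.
apply: le_trans (outer_measureU2 _ _ _) _.
by rewrite [e]splitr EFinD leeD// ltW.
Qed.

Context {Y : metricType R} (f : X -> Y).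
Hypothesis f_meas : outer_measurable_fun mu f.
Variable Dy : set Y.
Hypothesis Dy_countable : countable Dy.
Hypothesis Dy_dense : forall (y : Y) (e : R), 0 < e -> exists2 x, Dy x & mdist x y < e.

Lemma countable_ball_basis : exists B : nat -> set Y, (forall n, open (B n)) /\
  forall (O : set Y) y, open O -> O y -> exists n, B n y /\ B n `<=` O.
Proof.
have [p psurj] := nat_pair_surj; have /countable_injP[g g_inj] := Dy_countable.
exists (fun n => \bigcup_(d in Dy `&` [set d | g d = (p n).1])
  ball d ((p n).2.+1%:R^-1 : R)).
split; first by move=> n; apply: bigcup_open => d _; exact: mball_open.
move=> O y oO Oy; have : nbhs y O by exact: open_nbhs_nbhs.
rewrite -nbhs_ballE => -[r /= r0 yrO].
pose k := Num.truncn (2 / r).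
have kr : k.+1%:R^-1 < r / 2.
  rewrite -[ltRHS]invrK ltf_pV2 ?posrE ?invr_gt0 ?divr_gt0//.
  by rewrite invf_div; exact: truncnS_gt.
have k0 : 0 < k.+1%:R^-1 :> R by rewrite invr_gt0.
have [d Dd dy] := Dy_dense y k0.
have [n nE] := psurj (g d, k); exists n; rewrite nE /=; split.
  by exists d => //; rewrite ballEmdist.
move=> z [d' [Dd' /= gd']].
have -> : d' = d by apply: g_inj; rewrite ?inE.
rewrite ballEmdist /= => dz; apply: yrO; rewrite ballEmdist /=.
have := metric_triangle y d z; rewrite (metric_sym y d).
by move: kr dy dz; set e : R := _^-1; lra.
Qed.

(** Inside [E], the preimage of each basic set [B n] and its complement are approximated by closed
    sets [C n] and [C' n]. On the intersection of all the unions of [C n] and [C' n], that preimage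
    is cut out by the open complement of [C' n]. *)
Lemma lusin (E : set X) (e : R) : mu.-caratheodory E -> (mu E < +oo)%E ->
  0 < e -> exists C, [/\ closed C, C `<=` E, (mu (E `\` C) <= e%:E)%E &
    relatively_continuous C f].
Proof.
move=> mE Eoo e0; have [B [oB Bbase]] := countable_ball_basis.
have ex n : exists C C', [/\ closed C /\ closed C', C `<=` E `&` f @^-1` B n,
    C' `<=` E `&` ~` (f @^-1` B n) &
    (mu (E `\` (C `|` C')) <= (e / (2 ^ n.+1)%:R)%:E)%E].
  have e'0 : 0 < e / (2 ^ n.+1)%:R / 2 by rewrite !divr_gt0// ltr0n expn_gt0.
  have mB := f_meas (oB n).
  have Eioo A : (mu (E `&` A) < +oo)%E.
    by apply: le_lt_trans Eoo; apply: le_outer_measure; exact: subIsetl.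
  have [|C [cC CE Ce]] := inner_closed _ (Eioo (f @^-1` B n)) e'0.
    exact: caratheodory_measurable_setI.
  have [|C' [cC' C'E C'e]] := inner_closed _ (Eioo (~` (f @^-1` B n))) e'0.
    by apply: caratheodory_measurable_setI => //; exact: caratheodory_measurable_setC.
  exists C, C'; split => //.
  apply: (@le_trans _ _ (mu (((E `&` f @^-1` B n) `\` C) `|`
    ((E `&` ~` (f @^-1` B n)) `\` C')))).
    apply: le_outer_measure => x [Ex /not_orP[nC nC']].
    by have [?|?] := pselect ((f @^-1` B n) x); [left|right].
  apply: le_trans (outer_measureU2 _ _ _) _.
  by rewrite [_ / _]splitr EFinD leeD.
have [C] := choice ex => /choice[C' CP].
exists (\bigcap_n (C n `|` C' n)); split.
- by apply: closed_bigI => n _; apply: closedU; have [[]] := CP n.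
- by move=> x /(_ 0%N I)[]; have [_ CE C'E _] := CP 0%N; [move/CE|move/C'E]; case.
- rewrite setDE setC_bigcap setI_bigcupr.
  by apply: outer_measure_bigcup_geo => [|n]; [exact: ltW|have [] := CP n].
- move=> O oO; exists (\bigcup_(n in [set n | B n `<=` O]) ~` C' n).
    by apply: bigcup_open => n _; apply: closed_openC; have [[]] := CP n.
  apply/seteqP; split => x [Cx].
    move=> Ox; split => //; have [n [Bx BO]] := Bbase _ _ oO Ox.
    by exists n => // C'x; have [_ _ /(_ _ C'x)[]] := CP n.
  move=> [n /= BO nC'x]; split => //; apply: BO.
  by case: (Cx n I) => // Cnx; have [_ /(_ _ Cnx)[]] := CP n.
Qed.

Lemma compact_continuity_pieces (K : nat -> set X) (Z : set X) :
  sigma_finite_set mu [set: X] -> (forall i, compact (K i)) -> mu Z = 0%E ->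
  [set: X] = (\bigcup_i K i) `|` Z ->
  exists (L : nat -> set X) (N : set X),
    [/\ forall n, [/\ compact (L n), closed (L n), (mu (L n) < +oo)%E &
          relatively_continuous (L n) f],
        mu N = 0%E & [set: X] = (\bigcup_n L n) `|` N].
Proof.
move=> [F [Ffin FT]] cK Z0 KZ.
pose E i j := F j `&` K i.
have Kcl i : closed (K i) by apply: compact_closed => //; exact: regular_T1_hausdorff.
have mE i j : mu.-caratheodory (E i j).
  by apply: caratheodory_measurable_setI; [exact: (Ffin j).1|exact: closed_caratheodory].
have Eoo i j : (mu (E i j) < +oo)%E.
  by apply: le_lt_trans (Ffin j).2; apply: le_outer_measure; exact: subIsetl.
have [p psurj] := nat_pair_surj.
(* The index [n] codes a compact set, a set of finite measure and a precision; every triple occurs,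
   so what is missed in each [E i j] is null. *)
pose i_ n := (p (p n).1).1; pose j_ n := (p (p n).1).2; pose l_ n := (p n).2.
have ex n : exists C, [/\ closed C, C `<=` E (i_ n) (j_ n),
    (mu (E (i_ n) (j_ n) `\` C) <= ((l_ n).+1%:R^-1)%:E)%E & relatively_continuous C f].
  by apply: lusin => //; rewrite invr_gt0.
have [L LP] := choice ex.
exists L, (Z `|` \bigcup_i \bigcup_j (E i j `\` \bigcup_n L n)); split.
- move=> n; have [cL LE _ Lf] := LP n; split => //.
    by apply: subclosed_compact cL (cK (i_ n)) _ => x /LE[].
  by apply: le_lt_trans (Eoo (i_ n) (j_ n)); exact: le_outer_measure.
- apply/eqP; rewrite eq_le outer_measure_ge0 andbT.
  apply: le_trans (outer_measureU2 _ _ _) _; rewrite Z0 add0e.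
  rewrite outer_measure_bigcup_null// => i; apply: outer_measure_bigcup_null => j.
  apply/eqP; rewrite eq_le outer_measure_ge0 andbT; apply/lee_addgt0Pr => e e0.
  rewrite add0e; pose l := Num.truncn e^-1.
  have [a aE] := psurj (i, j); have [n nE] := psurj (a, l).
  have [_ _ + _] := LP n; rewrite /i_ /j_ /l_ nE /= aE /= => Ln.
  apply: (@le_trans _ _ (mu (E i j `\` L n))).
    by apply: le_outer_measure => x [Ex nLx]; split => // Lx; apply: nLx; exists n.
  apply: le_trans Ln _; rewrite lee_fin -[leRHS]invrK lef_pV2 ?posrE ?invr_gt0//.
  by apply/ltW; exact: truncnS_gt.
- apply/seteqP; split => // x _.
  have [Lx|nLx] := pselect ((\bigcup_n L n) x); [by left|right].
  have : ((\bigcup_i K i) `|` Z) x by rewrite -KZ.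
  move=> [[i _ Kx]|Zx]; [right|by left].
  have : (\bigcup_j F j) x by rewrite -FT.
  by move=> [j _ Fx]; exists i => //; exists j.
Qed.

End regular_spaces.

(** * Upper densities *)

Lemma finite_order_doubling {R : realType} (h : R -> R) :
  hausdorff_function h -> finite_order h ->
  exists C t0 : R, [/\ 0 < C, 0 < t0 &
    forall t, 0 < t -> t < t0 -> h (3 * t) <= C * h t].
Proof.
move=> [h0 _ _ hpos]; rewrite /finite_order limf_esupE.
move=> /ereal_inf_lt[_ [V V0 <-] Voo].
have [t0 /= t00 Vt] := V0.
set S := ereal_sup _ in Voo.
have VS t : V t -> ((h (3 * t) / h t)%:E <= S)%E.
  by move=> ?; apply: ereal_sup_ubound; exists t.
have V_t t : 0 < t -> t < t0 -> V t.
  by move=> ? ?; apply: Vt => //=; rewrite sub0r normrN gtr0_norm.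
exists (Num.max 1 (fine S)), t0; split => //.
  by rewrite lt_max ltr01.
move=> t tp tt0; have := VS _ (V_t _ tp tt0) => tS.
rewrite -ler_pdivrMr ?hpos// le_max; apply/orP; right.
rewrite -lee_fin fineK// fin_numE; apply/andP; split; last by rewrite -ltey.
by rewrite -ltNye (lt_le_trans _ tS)// ltNyr.
Qed.

(** * Vitali selection and density sets *)

Section vitali.
Context {R : realType} {X : Type} {Y : metricType R}.
Variables (mu : {outer_measure set X -> \bar R}) (f : X -> Y) (h : R -> R).
Hypothesis mu_sf : sigma_finite_set mu [set: X].
Hypothesis f_meas : outer_measurable_fun mu f.
Hypothesis h_haus : hausdorff_function h.
Hypothesis h_fo : finite_order h.
Variable L : set X.
Hypothesis L_meas : mu.-caratheodory L.
Hypothesis L_fin : (mu L < +oo)%E.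

Local Notation nu B := (mu (L `&` f @^-1` B)).

(* The selection property quantified over in Zorn's lemma only constrains the
   balls that meet the family, which makes it stable under unions of chains. *)
Lemma vitali_selection (P : set (Y * R)) (d : R) :
  (forall b, P b -> 0 < b.2 /\ b.2 <= d) ->
  exists S, [/\ S `<=` P, trivIset S (fun b => ball b.1 b.2) &
    forall b, P b -> exists s, [/\ S s, b.2 <= 2 * s.2 &
      ball b.1 b.2 `&` ball s.1 s.2 !=set0]].
Proof.
move=> Pd; pose Bl (b : Y * R) := ball b.1 b.2.
pose good S := forall b, P b -> (exists2 s, S s & Bl b `&` Bl s !=set0) ->
  exists s, [/\ S s, b.2 <= 2 * s.2 & Bl b `&` Bl s !=set0].
pose Q S := [/\ S `<=` P, trivIset S Bl & good S].
have [|S [[SP tS gS] maxS]] := @Zorn_bigcup _ Q.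
  move=> F FQ Ftot; split.
  - by apply: bigcup_sub => S /FQ[].
  - move=> a b [S FS Sa] [S' FS' S'b] ab.
    have [SS'|S'S] := Ftot _ _ FS FS'.
      by have [_ t _] := FQ _ FS'; apply: t => //; exact: SS'.
    by have [_ t _] := FQ _ FS; apply: t => //; exact: S'S.
  - move=> b Pb [s [S FS Ss] bs]; have [_ _ gS] := FQ _ FS.
    have [|s' [Ss' ? ?]] := gS b Pb; first by exists s.
    by exists s'; split => //; exists S.
exists S; split => // b Pb; apply: (gS) => //; apply: contrapT => nb.
(* If some ball misses the whole family, one whose radius exceeds half the supremum over such balls
   can be added, against maximality. *)
pose T := P `&` [set c | ~ exists2 s, S s & Bl c `&` Bl s !=set0].
have Tb : T b by [].
pose rs := [set c.2 | c in T].
have rs_sup : has_sup rs.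
  split; first by exists b.2, b.
  by exists d => _ [c [Pc _] <-]; have [] := Pd _ Pc.
have sup0 : 0 < sup rs.
  apply: (@lt_le_trans _ _ b.2); first by have [] := Pd _ Pb.
  by apply: ub_le_sup; [exact: rs_sup.2|exists b].
have half0 : 0 < sup rs / 2 by rewrite divr_gt0.
have [_ [c [Pc nc] <-] rc] := sup_adherent half0 rs_sup.
have Bc0 : Bl c c.1 by apply: ballxx; have [] := Pd _ Pc.
apply: (maxS (S `|` [set c])).
  split; first exact: subsetUl.
  by move=> Sc; apply: nc; exists c; [apply: Sc; right|exists c.1].
split; first by move=> x [/SP//|->].
  move=> x y [Sx|->] [Sy|->] // xy; first exact: tS.
    by exfalso; apply: nc; exists x => //; rewrite setIC.
  by exfalso; apply: nc; exists y.
move=> x Px [s [Ss|->] xs].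
  have [|s' [Ss' ? ?]] := gS x Px; first by exists s.
  by exists s'; split => //; left.
have [xS|nxS] := pselect (exists2 s, S s & Bl x `&` Bl s !=set0).
  by have [s' [Ss' ? ?]] := gS x Px xS; exists s'; split => //; left.
exists c; split => //; first by right.
have : x.2 <= sup rs by apply: ub_le_sup; [exact: rs_sup.2|exists x].
lra.
Qed.

Lemma upper_density_hausdorff_finite (E : set Y) (c : R) : 0 < c ->
  (forall y, E y -> forall d : R, 0 < d -> exists r, [/\ 0 < r, r < d &
    ((c * h r)%:E < nu (ball y r))%E]) ->
  (hausdorff_measure h E < +oo)%E.
Proof.
have [h_ge0 h_nd _ h_pos] := h_haus.
have [C [t0 [C0 t00 h3]]] := finite_order_doubling h_haus h_fo.
move=> c0 Ec.
have h9 r : 0 < r -> r < t0 / 3 -> h (9 * r) <= C ^+ 2 * h r.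
  move=> r0 rt; rewrite (_ : 9 * r = 3 * (3 * r)); last lra.
  apply: (le_trans (h3 _ _ _)); [lra|lra|].
  by rewrite expr2 -mulrA ler_pM2l// h3//; lra.
apply: (@le_lt_trans _ _ ((C ^+ 2 / c)%:E * mu L)%E); last first.
  rewrite -(@fineK _ (mu L)); first by rewrite -EFinM ltry.
  by rewrite ge0_fin_numE// outer_measure_ge0.
apply: measure_le => d d0.
(* Below [t0 / 3] the order condition applies twice, from [9 * r] down to [r]; [d / 9] keeps the
   enlarged balls of diameter at most [d]. *)
pose d' := Num.min (t0 / 3) (d / 9).
have d'0 : 0 < d' by rewrite lt_min !divr_gt0.
pose P := [set b : Y * R | [/\ E b.1, 0 < b.2, b.2 < d' &
  ((c * h b.2)%:E < nu (ball b.1 b.2))%E]].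
have [|S [SP tS Scov]] := @vitali_selection P d'.
  by move=> b [_ ? /ltW].
have mball (s : Y * R) : mu.-caratheodory (f @^-1` ball s.1 s.2).
  by apply: f_meas; exact: mball_open.
have cS : countable S.
  apply: (positive_disjoint_countable (J := fun s => L `&` f @^-1` ball s.1 s.2) mu_sf).
    move=> a b Sa Sb [x [[_ ax] [_ bx]]]; apply: tS => //; by exists (f x).
  move=> s Ss; split; first exact: caratheodory_measurable_setI.
  have [_ s0 _ sP] := SP _ Ss; apply: le_lt_trans sP.
  by rewrite lee_fin mulr_ge0 ?h_ge0// ltW.
have /countable_injP[g g_inj] := cS.
(* Only centres have to be covered: a ball of [P] meets a selected ball of at least half its radius,
   so its centre lies in the threefold enlargement. *)
pose U n := \bigcup_(s in S `&` [set s | g s = n]) ball s.1 (3 * s.2).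
pose A n := \bigcup_(s in S `&` [set s | g s = n]) f @^-1` ball s.1 s.2.
have UA n : (exists s, [/\ S s, U n = ball s.1 (3 * s.2) & A n = f @^-1` ball s.1 s.2])
    \/ (U n = set0 /\ A n = set0).
  have [[s [Ss gs]]|ns] := pselect (exists s, S s /\ g s = n).
    left; exists s.
    have e : S `&` [set s | g s = n] = [set s].
      apply/seteqP; split => [x [Sx /= gx]|x ->//].
      by apply: g_inj; rewrite ?inE// gs.
    by rewrite /U /A e !bigcup_set1.
  right; rewrite /U /A (_ : S `&` _ = set0) ?bigcup_set0//.
  by apply/seteqP; split => // x [? ?]; apply: ns; exists x.
apply: le_trans (content_le_cover _ (U := U) _ _) _.
- move=> n; have [[s [Ss -> _]]|[-> _]] := UA n; last by rewrite diam0 leNye.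
  have [_ s0 sd _] := SP _ Ss; move: sd; rewrite lt_min => /andP[_ sd].
  apply: diam_le => x y; rewrite ballEmdist /= => sx sy.
  rewrite lee_fin; have := metric_triangle x s.1 y; rewrite (metric_sym x s.1); lra.
- move=> y Ey; have [r [r0 rd' yr]] := Ec y Ey _ d'0.
  have [|s [Ss rs [z []]]] := Scov (y, r); first by split.
  rewrite /= !ballEmdist /= => yz sz; exists (g s) => //; exists s => //.
  rewrite ballEmdist /=; have := metric_triangle s.1 z y; rewrite (metric_sym z y).
  by move: rs => /=; lra.
have tA : trivIset setT A.
  move=> i j _ _ [x [[s [Ss gs] sx] [s' [Ss' gs'] s'x]]].
  by rewrite -gs -gs' (tS s s')//; exists (f x).
have mA n : mu.-caratheodory (A n).
  have [[s [_ _ ->]]|[_ ->]] := UA n; first exact: mball.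
  exact: caratheodory_measurable_set0.
(* The selected balls are disjoint, so their [nu]-measures add up to at most [mu L]; each exceeds
   [c * h s.2], which controls the gauge of the enlarged ball up to [C ^+ 2]. *)
apply: (@le_trans _ _ ((C ^+ 2 / c)%:E * \sum_(n <oo) mu (L `&` A n))%E); last first.
  rewrite lee_pmul2l ?lte_fin ?divr_gt0 ?exprn_gt0//.
  apply: le_trans (caratheodory_lime_le mA tA L).
  by rewrite leeDl// outer_measure_ge0.
rewrite -nneseriesZl; last by move=> *; exact: outer_measure_ge0.
apply: lee_nneseries => [n _ _|n _]; first exact: gauge_ge0.
have [[s [Ss -> ->]]|[-> ->]] := UA n; last first.
  by rewrite gauge0 setI0 outer_measure0 mule0.
have [_ s0 sd sP] := SP _ Ss; move: sd; rewrite lt_min => /andP[st sd].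
apply: (@le_trans _ _ (h (9 * s.2))%:E).
  apply: gauge_le => //; first by rewrite mulr_ge0// ltW.
  apply: diam_le => x y; rewrite ballEmdist /= => sx sy.
  rewrite lee_fin; have := metric_triangle x s.1 y; rewrite (metric_sym x s.1); lra.
apply: (@le_trans _ _ ((C ^+ 2 / c)%:E * (c * h s.2)%:E)%E); last first.
  by rewrite lee_pmul2l ?lte_fin ?divr_gt0 ?exprn_gt0// ltW.
by rewrite -EFinM lee_fin mulrA divfK ?gt_eqF// h9.
Qed.

(** Two radii [s < r] make the set closed: if the bound fails at [y], then a ball around any nearby
    centre, with radius between [s] and [r], contains the offending ball. *)
Definition low_density (n m : nat) : set Y := [set y | forall s r : R,
  0 < s -> s < r -> r < m.+1%:R^-1 -> (nu (ball y s) <= (h r / n.+1%:R)%:E)%E].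

Lemma low_density_closed n m : closed (low_density n m).
Proof.
rewrite -openC openE => y /existsNP[s /existsNP[r]].
move=> /not_implyP[s0 /not_implyP[sr /not_implyP[rm /negP]]].
rewrite -ltNge => nuy; rewrite /interior -nbhs_ballE.
exists ((r - s) / 2) => /=; first by rewrite divr_gt0// subr_gt0.
move=> z yz Az; move: nuy; apply/negP; rewrite -leNgt.
apply: le_trans (Az (s + (r - s) / 2) r _ _ _) => //; [|lra|lra].
apply: le_outer_measure => x [Lx]; rewrite /= !ballEmdist /= => yx; split => //=.
move: yz; rewrite ballEmdist /= => yz.
have := metric_triangle z y (f x); rewrite (metric_sym z y); lra.
Qed.

Lemma low_density_mono n m m' : (m <= m')%N -> low_density n m `<=` low_density n m'.
Proof.
move=> mm' y Ay s r s0 sr rm; apply: Ay => //; apply: lt_le_trans rm _.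
by rewrite lef_pV2 ?posrE// ler_nat ltnS.
Qed.

Lemma high_density_hausdorff_finite n :
  (hausdorff_measure h (~` \bigcup_m low_density n m) < +oo)%E.
Proof.
have [h_ge0 h_nd _ h_pos] := h_haus.
apply: (@upper_density_hausdorff_finite _ n.+1%:R^-1); first by rewrite invr_gt0.
move=> y nAy d d0; pose m := Num.truncn d^-1.
have md : m.+1%:R^-1 < d.
  by rewrite -[ltRHS]invrK ltf_pV2 ?posrE ?invr_gt0//; exact: truncnS_gt.
have : ~ low_density n m y by move=> Ay; apply: nAy; exists m.
move=> /existsNP[s /existsNP[r]].
move=> /not_implyP[s0 /not_implyP[sr /not_implyP[rm /negP]]].
rewrite -ltNge => nuy; exists s; split => //.
  exact: lt_trans sr (lt_trans rm md).
apply: le_lt_trans nuy; rewrite lee_fin mulrC ler_pM2r ?invr_gt0//.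
by apply: h_nd; exact: ltW.
Qed.

End vitali.

(** * Null sets with image of positive measure *)

Lemma compact_cover_compact {X : topologicalType} (A : set X) :
  compact A -> cover_compact A.
Proof.
have [->|/set0P[x0 _]] := eqVneq A set0.
  by move=> _ I D f _ _; exists finmap.fset0.
pose X' : ptopologicalType := HB.pack_for ptopologicalType X (isPointed.Build X x0).
move=> cA; suff : @cover_compact X' A by [].
by rewrite -compact_cover.
Qed.

Lemma compact_increasing_cover {X : topologicalType} (L : set X)
    (O : nat -> set X) : compact L -> (forall n, open (O n)) ->
  (forall m n, (m <= n)%N -> O m `<=` O n) -> L `<=` \bigcup_n O n ->
  exists n, L `<=` O n.
Proof.
move=> /compact_cover_compact cL oO ndO LO.
have [D _ LD] := cL _ setT O (fun n _ => oO n) LO.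
exists (\max_(i <- finmap.enum_fset D) i)%N => x /LD[i /= iD Ox].
by apply: ndO Ox; apply: (@leq_bigmax_seq _ _ xpredT id).
Qed.

(** Right continuity of [h] leaves room for a [d] above the diameter at small cost, and half of this
    room is spent on an open neighbourhood of [U]. Open covers make compactness available in the
    mass distribution argument. *)
Lemma gauge_open_enlarge {R : realType} {Y : metricType R} (h : R -> R)
    (U : set Y) (a b e : R) : hausdorff_function h -> h 0 = 0 ->
  (diam U <= a%:E)%E -> 0 <= a -> a < b -> 0 < e ->
  exists V d, [/\ open V, U `<=` V, 0 < d /\ d < b,
    forall x y, V x -> V y -> mdist x y <= d &
    ((h d)%:E <= hausdorff_gauge h U + e%:E)%E].
Proof.
move=> [h_ge0 h_nd h_rc _] h0 Ua a0 ab e0.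
have [D [D0 Da UD hD]] : exists D, [/\ 0 <= D, D <= a,
    forall x y, U x -> U y -> mdist x y <= D & hausdorff_gauge h U = (h D)%:E].
  (* The empty set has gauge 0, which is [h 0], so it is treated as having diameter 0. *)
  have [U0|/set0P U0] := eqVneq U set0.
    by exists 0; split => //; [move=> x y; rewrite U0|rewrite U0 gauge0 h0].
  have Ufin : diam U \is a fin_num.
    by rewrite ge0_fin_numE ?diam_ge0// (le_lt_trans Ua)// ltry.
  exists (fine (diam U)); split; first exact: fine_diam_ge0.
  - by rewrite -lee_fin fineK.
  - by move=> x y Ux Uy; rewrite -lee_fin fineK// diam_ub.
  - by rewrite /hausdorff_gauge ifF//; apply/negbTE/set0P.
have [d [Dd db hd]] : exists d, [/\ D < d, d < b & h d < h D + e].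
  have hn : \forall x \near D^'+, h x < h D + e.
    by apply: (cvgr_lt (h D) (h_rc D D0)); rewrite ltrDl.
  have bn : \forall x \near D^'+, x < b by apply: nbhs_right_lt; exact: le_lt_trans ab.
  have Dn : \forall x \near D^'+, D < x by exact: nbhs_right_gt.
  have : \forall x \near D^'+, [/\ D < x, x < b & h x < h D + e].
    by near=> x; split; near: x.
  by move=> /filter_ex[x xP]; exists x.
exists (\bigcup_(u in U) ball u ((d - D) / 2)), d; split.
- by apply: bigcup_open => u _; exact: mball_open.
- by move=> x Ux; exists x => //; apply: ballxx; rewrite divr_gt0// subr_gt0.
- by split => //; exact: le_lt_trans Dd.
- move=> x y [u Uu] + [v Uv]; rewrite !ballEmdist /= => ux vy.
  have := metric_triangle x u y; have := metric_triangle u v y.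
  have := UD _ _ Uu Uv; rewrite (metric_sym x u); lra.
- by rewrite hD -EFinD lee_fin ltW.
Unshelve. all: by end_near. Qed.

(** * Concentrating a measure at ever smaller scales *)

Section cantor.
Context {R : realType} {X : topologicalType} {Y : metricType R}.
Variables (mu : {outer_measure set X -> \bar R}) (f : X -> Y) (h : R -> R).
Hypothesis mu_closed : forall C : set X, closed C -> mu.-caratheodory C.
Hypothesis mu_inner : forall (E : set X) (e : R), mu.-caratheodory E ->
  (mu E < +oo)%E -> 0 < e ->
  exists C, [/\ closed C, C `<=` E & (mu (E `\` C) <= e%:E)%E].
Hypothesis f_meas : outer_measurable_fun mu f.
Hypothesis h_haus : hausdorff_function h.
Hypothesis h_fo : finite_order h.
Hypothesis h0 : h 0 = 0.
Variable L : set X.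
Hypothesis L_compact : compact L.
Hypothesis L_closed : closed L.
Hypothesis L_fin : (mu L < +oo)%E.
Hypothesis L_cont : relatively_continuous L f.
Hypothesis L_growth : forall e : R, 0 < e -> exists2 r0 : R, 0 < r0 &
  forall x (r : R), L x -> 0 < r -> r < r0 ->
    (mu (L `&` f @^-1` ball (f x) r) <= (e * h r)%:E)%E.

Let m (A : set X) : R := fine (mu (L `&` A)).

Let mu_m (A : set X) : mu (L `&` A) = (m A)%:E.
Proof.
rewrite /m fineK// ge0_fin_numE ?outer_measure_ge0//; apply: le_lt_trans L_fin.
by apply: le_outer_measure; exact: subIsetl.
Qed.

Let m_ge0 A : 0 <= m A. Proof. by rewrite fine_ge0// outer_measure_ge0. Qed.

Let m_mono A B : L `&` A `<=` B -> m A <= m B.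
Proof.
move=> AB; rewrite -lee_fin -!mu_m; apply: le_outer_measure => x [Lx Ax].
by split => //; exact: AB.
Qed.

Let m0 : m set0 = 0. Proof. by rewrite /m setI0 outer_measure0. Qed.

Let mU A B : m (A `|` B) <= m A + m B.
Proof. by rewrite -lee_fin EFinD -!mu_m setIUr; exact: outer_measureU2. Qed.

Let m_split A B : mu.-caratheodory B -> m A = m (A `&` B) + m (A `&` ~` B).
Proof.
by move=> mB; apply: EFin_inj; rewrite EFinD -!mu_m (mB (L `&` A)) !setIA.
Qed.

Let mball x r : mu.-caratheodory (f @^-1` ball (f x) r).
Proof. by apply: f_meas; exact: mball_open. Qed.

Let finite_net (r : R) : 0 < r -> exists s : seq X,
  (forall y, y \in s -> L y) /\
  forall x, L x -> exists2 y, y \in s & ball (f y) r (f x).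
Proof.
move=> r0.
have [W WP] := choice (fun x => (exists2P _ _).1 (L_cont (mball_open (f x) r))).
have cL := compact_cover_compact L_compact.
have [||D DL LD] := cL _ L W; first by move=> x _; have [] := WP x.
  move=> x Lx; exists x => //; have [_ WE] := WP x.
  suff : (L `&` W x) x by case.
  by rewrite -WE; split => //=; exact: ballxx.
exists (finmap.enum_fset D); split; first by move=> y yD; exact/set_mem/DL.
move=> x Lx; have [y /= yD Wx] := LD _ Lx; exists y => //.
have [_ WE] := WP y; have : (L `&` W y) x by [].
by rewrite -WE => -[].
Qed.

(** Balls of the net are removed one at a time while mass at least [a] remains. The last set before
    the mass drops below [a] has mass at most [a + a], since one ball carries at most [a]. *)
Let slice (s : seq X) (r a : R) (E : set X) : 0 < a -> mu.-caratheodory E ->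
  (forall x, E x -> exists2 y, y \in s & ball (f y) r (f x)) ->
  (forall y, y \in s -> m (f @^-1` ball (f y) r) <= a) -> a <= m E ->
  exists F, [/\ mu.-caratheodory F, F `<=` E & a <= m F <= a + a].
Proof.
move=> a0; elim: s E => [|y s ih] E mE Es sa aE.
  have E0 : E = set0 by apply/seteqP; split => // x /Es[].
  by move: aE; rewrite E0 m0 leNgt a0.
pose B := f @^-1` ball (f y) r.
have [aE'|E'a] := leP a (m (E `&` ~` B)).
  have [||||F [mF FE aF]] := ih (E `&` ~` B).
  - apply: caratheodory_measurable_setI => //; apply: caratheodory_measurable_setC.
    exact: mball.
  - move=> x [/Es[z]]; rewrite inE => /orP[/eqP -> yx nB|zs zx _]; first by [].
    by exists z.
  - by move=> z zs; apply: sa; rewrite inE zs orbT.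
  - by [].
  - by exists F; split => // x /FE[].
exists E; split => //; rewrite aE /= (m_split E (mball y r)) lerD//; last exact: ltW.
apply: le_trans (sa y _); last by rewrite inE eqxx.
by apply: m_mono => x [_ []].
Qed.

Let h_small (a : R) : 0 < a -> exists2 r0, 0 < r0 & forall r, 0 < r -> r < r0 -> h r <= a.
Proof.
move=> a0; have [_ h_nd h_rc _] := h_haus.
have := h_rc 0 (lexx 0); rewrite h0 => /cvgrPdist_lt/(_ _ a0)[r0 /= r00 hr].
exists r0 => // r rp rr0; have := hr r; rewrite /= sub0r normrN gtr0_norm// sub0r normrN.
by move=> /(_ rr0 rp)/ltW; apply: le_trans; exact: ler_norm.
Qed.

(** Slicing at a quarter of the mass gives a set with between a quarter and a half of it; the closed
    approximation loses at most an eighth. This is the origin of the factor 8. *)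
Let halving E : mu.-caratheodory E -> E `<=` L -> 0 < m E ->
  exists Q, [/\ closed Q, Q `<=` E, m E <= 8 * m Q & 2 * m Q <= m E].
Proof.
move=> mE EL E0; pose a := m E / 4.
have a0 : 0 < a by rewrite divr_gt0.
have [r1 r10 G] := L_growth ltr01; have [r2 r20 hr] := h_small a0.
pose r := Num.min r1 r2 / 2.
have rm : 0 < Num.min r1 r2 by rewrite lt_min r10.
have [r_gt0 rr1 rr2] : [/\ 0 < r, r < r1 & r < r2].
  have : r < Num.min r1 r2 by rewrite /r; lra.
  by rewrite lt_min => /andP[? ?]; rewrite divr_gt0.
have [s [sL sP]] := finite_net r_gt0.
have [|||F [mF FE /andP[aF Fa]]] := @slice s r a E a0 mE.
- by move=> x /EL/sP.
- move=> y /sL Ly; rewrite -lee_fin -mu_m (le_trans (G y r Ly r_gt0 rr1))//.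
  by rewrite mul1r lee_fin hr.
- by rewrite /a; lra.
have FL : F `<=` L by exact: subset_trans EL.
have [||Q [cQ QF Qe]] := mu_inner mF _ (_ : 0 < m E / 8).
- by apply: le_lt_trans L_fin; exact: le_outer_measure.
- by rewrite divr_gt0.
exists Q; split => //; first exact: subset_trans FE.
  have := m_split F (mu_closed cQ); rewrite (setIidr QF) => FQ.
  have : m (F `&` ~` Q) <= m E / 8.
    rewrite -lee_fin -mu_m; apply: le_trans Qe; apply: le_outer_measure.
    by rewrite setDE; exact: subIsetr.
  by move: FQ aF; rewrite /a; lra.
have : m Q <= m F by apply: m_mono => x [_ /QF].
by move: Fa; rewrite /a; lra.
Qed.

(** A closed neighbourhood for the pseudometric that [f] pulls back from [Y]. *)
Definition nbhd (r : R) (A : set X) : set X :=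
  [set x | exists2 a, A a & mdist (f a) (f x) <= r].

(* The list [S] stands for the measure whose density with respect to [m] is
   [c] on [Q] for every [(c, Q)] in [S]. *)
Definition lam (S : seq (R * set X)) (A : set X) : R :=
  \sum_(p <- S) p.1 * m (p.2 `&` A).

(** The densities are left out on purpose: this bounds the [mu]-measure of the carrier, whereas
    [lam S setT] is the total of the represented measure. *)
Definition mass (S : seq (R * set X)) : R := \sum_(p <- S) m p.2.

Definition admissible (S : seq (R * set X)) :=
  forall p, p \in S -> [/\ 0 <= p.1, closed p.2 & p.2 `<=` L].

(** The factor 8 controls scales larger than those reached so far, the displacement bound [r]
    controls smaller steps to come, and the halving of [mass] makes the limit carrier null. *)
Definition refines (r : R) (S S' : seq (R * set X)) := [/\
  lam S' setT = lam S setT,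
  forall A, lam S' A <= 8 * lam S A /\ lam S' A <= lam S (nbhd r A),
  2 * mass S' <= mass S &
  forall p', p' \in S' -> [/\ 0 <= p'.1, closed p'.2 &
    exists2 p, p \in S & p'.2 `<=` p.2]].

Lemma lam_cat S1 S2 A : lam (S1 ++ S2) A = lam S1 A + lam S2 A.
Proof. by rewrite /lam big_cat. Qed.

Lemma mass_cat S1 S2 : mass (S1 ++ S2) = mass S1 + mass S2.
Proof. by rewrite /mass big_cat. Qed.

Lemma lam1 c Q A : lam [:: (c, Q)] A = c * m (Q `&` A).
Proof. by rewrite /lam big_seq1. Qed.

Lemma mass1 c Q : mass [:: (c, Q)] = m Q.
Proof. by rewrite /mass big_seq1. Qed.

Lemma lam_nil A : lam [::] A = 0. Proof. by rewrite /lam big_nil. Qed.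
Lemma mass_nil : mass [::] = 0. Proof. by rewrite /mass big_nil. Qed.

Lemma refines_cat r S1 S2 S1' S2' : refines r S1 S1' -> refines r S2 S2' ->
  refines r (S1 ++ S2) (S1' ++ S2').
Proof.
move=> [t1 b1 m1 s1] [t2 b2 m2 s2]; split.
- by rewrite !lam_cat t1 t2.
- by move=> A; rewrite !lam_cat; have := b1 A; have := b2 A; lra.
- by rewrite !mass_cat; lra.
- move=> p; rewrite mem_cat => /orP[/s1|/s2][p0 cp [q qS pq]]; split => //;
    by exists q => //; rewrite mem_cat qS ?orbT.
Qed.

(** The whole weight of [E] is put uniformly on the set [Q] from [halving]. The image of [E] lies in
    a ball of radius [r / 2], so every point of [E] is within [r] of every point of [Q]. *)
Lemma refines_one r c E z : 0 <= c -> mu.-caratheodory E -> E `<=` L ->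
  E `<=` f @^-1` ball z (r / 2) -> exists S', refines r [:: (c, E)] S'.
Proof.
move=> c0 mE EL Ez.
have [E0|E0] := leP (m E) 0.
  have {}E0 : m E = 0 by apply/eqP; rewrite eq_le E0 m_ge0.
  exists [::]; split => //.
  - by rewrite lam_nil lam1 setIT E0 mulr0.
  - by move=> A; rewrite lam_nil !lam1 !mulr_ge0.
  - by rewrite mass_nil mass1 mulr0.
have [Q [cQ QE EQ8 QE2]] := halving mE EL E0.
have Q0 : 0 < m Q by lra.
exists [:: (c * m E / m Q, Q)]; split.
- by rewrite !lam1 !setIT divfK// gt_eqF.
- move=> A; rewrite !lam1; split.
    have : m (Q `&` A) <= m (E `&` A) by apply: m_mono => x [_ [/QE]].
    have : c * m E / m Q <= 8 * c.
      by rewrite ler_pdivrMr// -mulrA mulrCA ler_wpM2l.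
    move=> cQ8 QA; rewrite mulrA; apply: ler_pM => //.
    by rewrite divr_ge0// mulr_ge0.
  have [QA0|/set0P[x [Qx Ax]]] := eqVneq (Q `&` A) set0.
    by rewrite QA0 m0 mulr0 mulr_ge0.
  have -> : m (E `&` nbhd r A) = m E.
    congr m; apply/setIidl => y Ey; exists x => //.
    have := Ez _ Ey; have := Ez _ (QE _ Qx); rewrite /= !ballEmdist /= => zx zy.
    have := metric_triangle (f x) z (f y); rewrite (metric_sym (f x) z); lra.
  rewrite mulrAC ler_pdivrMr// ler_wpM2l ?mulr_ge0//.
  by apply: m_mono => ? [_ []].
- by rewrite !mass1.
- move=> p; rewrite inE => /eqP -> /=; split => //.
    by rewrite divr_ge0// mulr_ge0.
  by exists (c, E) => //; rewrite inE.
Qed.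

(** [E] is cut along a finite net of radius [r / 2], provided by compactness of [L], and each part
    is refined on its own. *)
Lemma refines_piece r c E : 0 < r -> 0 <= c -> mu.-caratheodory E -> E `<=` L ->
  exists S', refines r [:: (c, E)] S'.
Proof.
move=> r0 c0 mE EL; have r2 : 0 < r / 2 by rewrite divr_gt0.
have [s [_ sP]] := finite_net r2.
have {sP} : forall x, E x -> exists2 y, y \in s & ball (f y) (r / 2) (f x).
  by move=> x /EL/sP.
elim: s E mE EL => [|y s ih] E mE EL Es.
  have E0 : E = set0 by apply/seteqP; split => // x /Es[].
  exists [::]; split => //; first by rewrite lam_nil lam1 E0 set0I m0 mulr0.
    by move=> A; rewrite lam_nil !lam1 !mulr_ge0.
  by rewrite mass_nil mass1 mulr0.
pose B := f @^-1` ball (f y) (r / 2).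
have [|||S1 S1P] := @refines_one r c (E `&` B) (f y) c0.
- by apply: caratheodory_measurable_setI => //; exact: mball.
- by move=> x [/EL].
- by move=> x [].
have [|||S2 S2P] := ih (E `&` ~` B).
- apply: caratheodory_measurable_setI => //; apply: caratheodory_measurable_setC.
  exact: mball.
- by move=> x [/EL].
- move=> x [/Es[z]]; rewrite inE => /orP[/eqP -> yx nB|zs zx _]; first by [].
  by exists z.
have [t b ma sp] := refines_cat S1P S2P.
have lamE A : lam ([:: (c, E `&` B)] ++ [:: (c, E `&` ~` B)]) A = lam [:: (c, E)] A.
  rewrite lam_cat !lam1 -mulrDr (m_split (E `&` A) (mball y (r / 2))).
  by rewrite (setIAC E B A) (setIAC E (~` B) A).
exists (S1 ++ S2); split.
- by rewrite t lamE.
- by move=> A; have := b A; rewrite !lamE.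
- by move: ma; rewrite (mass_cat [:: _]) !mass1 -m_split//; exact: mball.
- move=> p /sp[p0 cp [q qS pq]]; split => //; exists (c, E); first by rewrite inE.
  by apply: subset_trans pq _; move: qS; rewrite !inE => /orP[]/eqP -> x [].
Qed.

Lemma refines_ex r S : 0 < r -> admissible S -> exists S', refines r S S'.
Proof.
move=> r0; elim: S => [|[c E] S ih] aS.
  exists [::]; split => //; first by move=> A; rewrite !lam_nil mulr0.
  by rewrite mass_nil mulr0.
have [|S2 S2P] := ih; first by move=> p pS; apply: aS; rewrite inE pS orbT.
have [c0 cE EL] := aS (c, E) (mem_head _ _).
have [S1 S1P] := refines_piece r0 c0 (mu_closed cE) EL.
by exists (S1 ++ S2); exact: refines_cat S1P S2P.
Qed.

Lemma admissible_refines r S S' : admissible S -> refines r S S' -> admissible S'.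
Proof.
move=> aS [_ _ _ sp] p /sp[p0 cp [q /aS[_ _ qL] pq]]; split => //.
exact: subset_trans qL.
Qed.

Lemma lam_mono S A B : admissible S -> A `<=` B -> lam S A <= lam S B.
Proof.
move=> aS AB; rewrite /lam big_seq [leRHS]big_seq; apply: ler_sum => p /aS[p0 _ _].
by rewrite ler_wpM2l//; apply: m_mono => x [_ [? /AB]].
Qed.

Lemma lamU S A B : admissible S -> lam S (A `|` B) <= lam S A + lam S B.
Proof.
move=> aS; rewrite /lam -big_split /= big_seq [leRHS]big_seq.
apply: ler_sum => p /aS[p0 _ _].
by rewrite -mulrDr ler_wpM2l// setIUr.
Qed.

Definition carrier (S : seq (R * set X)) : set X := \big[setU/set0]_(p <- S) p.2.

Lemma carrierP S x : carrier S x <-> exists2 p, p \in S & p.2 x.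
Proof.
rewrite /carrier; elim: S => [|p S ih].
  by rewrite big_nil; split => // -[].
rewrite big_cons; split => [[px|/ih[q qS qx]]|[q]].
- by exists p => //; rewrite inE eqxx.
- by exists q => //; rewrite inE qS orbT.
- rewrite inE => /orP[/eqP -> px|qS qx]; first by left.
  by right; apply/ih; exists q.
Qed.

Lemma carrier_mass S : m (carrier S) <= mass S.
Proof.
rewrite /carrier /mass; elim: S => [|p S ih]; first by rewrite !big_nil m0.
by rewrite !big_cons (le_trans (mU _ _))// lerD2l.
Qed.

Lemma null_set_positive_image : (0 < mu L)%E ->
  exists N : set X, mu N = 0%E /\ (0 < hausdorff_measure h (f @` N))%E.
Proof.
move=> L0; have [h_ge0 h_nd h_rc h_pos] := h_haus.
have [C [t0 [C0 t00 h3]]] := finite_order_doubling h_haus h_fo.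
have mL0 : 0 < m L by rewrite -lte_fin -mu_m setIid.
(* The growth hypothesis is applied with [(8 ^+ k * C ^+ 2)^-1]: [8 ^+ k] offsets the density after
   [k] steps and [C ^+ 2] the passage from [h (9 * d)] to [h d]. *)
have ex k : exists r, 0 < r /\ forall x d, L x -> 0 < d -> d < r ->
    8 ^+ k * m (f @^-1` ball (f x) (9 * d)) <= h d.
  have e0 : 0 < (8 ^+ k * C ^+ 2)^-1 by rewrite invr_gt0 mulr_gt0 ?exprn_gt0.
  have [r0 r00 G] := L_growth e0.
  exists (Num.min (r0 / 9) (t0 / 3)); split; first by rewrite lt_min !divr_gt0.
  move=> x d Lx d0; rewrite lt_min => /andP[dr dt].
  have h9 : h (9 * d) <= C ^+ 2 * h d.
    rewrite (_ : 9 * d = 3 * (3 * d)); last lra.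
    apply: (le_trans (h3 _ _ _)); [lra|lra|].
    by rewrite expr2 -mulrA ler_pM2l// h3//; lra.
  have := G x (9 * d) Lx; rewrite mu_m lee_fin => Gx.
  rewrite -ler_pdivlMl ?exprn_gt0//; apply: le_trans (Gx _ _) _; [lra|lra|].
  rewrite invfM -mulrA ler_pM2l ?invr_gt0 ?exprn_gt0//.
  by rewrite ler_pdivrMl// exprn_gt0.
have [r rP] := choice ex.
(* The scales at least halve, so all displacements after step [k] add up to at most
   [2 * rho k.+1]. *)
pose rho := fix rho k := if k is k'.+1 then Num.min (r k) (rho k' / 2) else r 0%N.
have rho_r k : rho k <= r k by case: k => [|k] //=; rewrite ge_min lexx.
have rho_half k : 2 * rho k.+1 <= rho k.
  have : rho k.+1 <= rho k / 2 by rewrite /= ge_min lexx orbT.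
  lra.
have rho0 k : 0 < rho k.
  elim: k => [|k ih] /=; first by have [] := rP 0%N.
  by rewrite lt_min divr_gt0// (rP k.+1).1.
have rhoP k x d : L x -> 0 < d -> d < rho k ->
    8 ^+ k * m (f @^-1` ball (f x) (9 * d)) <= h d.
  by move=> Lx d0 dr; apply: (rP k).2 => //; exact: lt_le_trans (rho_r k).
have step (q : R * seq (R * set X)) : exists S', 0 < q.1 -> admissible q.2 ->
    refines q.1 q.2 S'.
  have [q0|q0] := pselect (0 < q.1 /\ admissible q.2); last first.
    by exists [::] => ? ?; exfalso; apply: q0.
  by have [S' ?] := refines_ex q0.1 q0.2; exists S'.
have [next nextP] := choice step.
(* The start is [mu] restricted to [L]; the step to [S n] moves weight by at most [rho n] in the
   image. *)
pose S := fix S n := if n is n'.+1 then next (rho n, S n') else [:: (1, L)].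
have aS n : admissible (S n).
  elim: n => [|n ih].
    by move=> p; rewrite inE => /eqP ->; split => //; exact: ler01.
  exact: admissible_refines ih (nextP (rho n.+1, S n) (rho0 n.+1) ih).
have SR n : refines (rho n.+1) (S n) (S n.+1).
  exact: (nextP (rho n.+1, S n) (rho0 n.+1) (aS n)).
have lamT n : lam (S n) setT = m L.
  elim: n => [|n ih]; first by rewrite /= lam1 mul1r setIT.
  by have [-> _ _ _] := SR n.
have lam8 n A : lam (S n) A <= 8 ^+ n * m A.
  elim: n => [|n ih].
    by rewrite /= lam1 expr0 !mul1r; apply: m_mono => x [_ []].
  have [_ /(_ A)[lA _] _ _] := SR n.
  by rewrite (le_trans lA)// exprS -mulrA ler_pM2l.
have lam_nbhd i k A : lam (S (k + i).+1) A <= lam (S k) (nbhd (2 * rho k.+1) A).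
  elim: i k => [|i ih] k.
    rewrite addn0; have [_ /(_ A)[_ lA] _ _] := SR k; apply: le_trans lA _.
    apply: lam_mono => // x [a Aa ax]; exists a => //.
    by have := rho0 k.+1; lra.
  rewrite addnS -addSn; apply: le_trans (ih k.+1) _.
  have [_ /(_ (nbhd (2 * rho k.+2) A))[_ lA] _ _] := SR k; apply: le_trans lA _.
  apply: lam_mono => // x [b [a Aa ab] bx]; exists a => //.
  have := metric_triangle (f a) (f b) (f x); have := rho_half k.+1; lra.
have mass2 n : 2 ^+ n * mass (S n) <= m L.
  elim: n => [|n ih]; first by rewrite /= mass1 expr0 mul1r.
  have [_ _ mS _] := SR n; apply: le_trans ih.
  by rewrite exprSr -mulrA ler_pM2l// exprn_gt0.
pose K n := carrier (S n).
have Kcl n : closed (K n) by apply: closed_bigsetU => p /aS[].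
have Knest n : K n.+1 `<=` K n.
  have [_ _ _ sp] := SR n.
  move=> x /carrierP[p /sp[_ _ [q qS pq]] px]; apply/carrierP.
  by exists q => //; exact: pq.
have Kmono i j : (i <= j)%N -> K j `<=` K i.
  move=> ij; rewrite -(subnK ij); elim: (j - i)%N => // k ih.
  by rewrite addSn; exact: subset_trans ih.
have KL n : K n `<=` L by move=> x /carrierP[p /aS[_ _ pL] /pL].
exists (\bigcap_n K n); split.
  rewrite -(@setIidr _ L (\bigcap_n K n)); last by move=> x /(_ 0%N I)/KL.
  rewrite mu_m; congr EFin; apply/eqP; rewrite eq_le m_ge0 andbT.
  apply/ler_addgt0Pr => e e0; rewrite add0r.
  pose n := Num.truncn (m L / e).
  have mn : m (\bigcap_n K n) <= mass (S n).
    by apply: le_trans (carrier_mass _); apply: m_mono => x [_ /(_ n I)].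
  apply: le_trans mn _; have := mass2 n; rewrite -ler_pdivlMl ?exprn_gt0// => /le_trans.
  apply; rewrite ler_pdivrMl ?exprn_gt0// -ler_pdivrMr//.
  apply: (@le_trans _ _ n.+1%:R); first by apply/ltW; exact: truncnS_gt.
  by rewrite -natrX ler_nat ltn_expl.
rewrite lt_neqAle hausdorff_measure_ge0// andbT; apply/eqP => /esym HK.
(* Sets of diameter [d] with [rho k.+1 <= d < rho k] are charged to stage [k]: its density is at
   most [8 ^+ k], and later steps move weight by at most [2 * d]. Points of the resulting
   neighbourhood are within [5 * d] of each other, hence the ball of radius [9 * d]. *)
have lam_h n V d : 0 < d -> d < rho 0%N ->
    (forall x y, V x -> V y -> mdist x y <= d) -> lam (S n) (f @^-1` V) <= h d.
  move=> d0 dr Vd; pose A := f @^-1` V.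
  have bound k : d < rho k -> 8 ^+ k * m (nbhd (2 * d) A) <= h d.
    move=> dk.
    have [LA|/set0P[x [Lx [a Va ax]]]] := eqVneq (L `&` nbhd (2 * d) A) set0.
      rewrite (_ : m _ = 0) ?mulr0 ?h_ge0 ?ltW//.
      by rewrite /m LA outer_measure0.
    apply: le_trans (rhoP k x d Lx d0 dk); rewrite ler_pM2l ?exprn_gt0//.
    apply: m_mono => y [_ [b Vb by_]] /=; rewrite ballEmdist /=.
    have := metric_triangle (f x) (f a) (f y); rewrite (metric_sym (f x) (f a)).
    have := metric_triangle (f a) (f b) (f y); have := Vd _ _ Va Vb; lra.
  have [k [kn dk]] : exists k, (k <= n)%N /\ d < rho k /\
      (k = n \/ (k < n)%N /\ rho k.+1 <= d).
    elim: n => [|n [k [kn [dk kP]]]]; first by exists 0%N; split => //; split => //; left.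
    have [kn1|[kn1 dk1]] := kP; last first.
      by exists k; split; [exact: leqW|split => //; right; split => //; exact: leqW].
    have [dn|dn] := ltP d (rho n.+1); first by exists n.+1; split => //; split => //; left.
    by subst k; exists n; split; [exact: leqW|split => //; right].
  case: dk => dk [kE|[kn1 dk1]].
    subst k; apply: le_trans (bound n dk); apply: le_trans (lam8 n A) _.
    rewrite ler_pM2l ?exprn_gt0//; apply: m_mono => x [_ Ax]; exists x => //.
    by rewrite mdistxx mulr_ge0// ltW.
  apply: le_trans (bound k dk); apply: le_trans (lam8 k _).
  have := lam_nbhd (n - k.+1)%N k A; rewrite -addSn subnKC// => /le_trans; apply.
  apply: lam_mono => // x [a Aa ax]; exists a => //; lra.
have b2 : 0 < rho 0%N / 2 by rewrite divr_gt0.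
(* The cover costs less than [m L / 2] and its open enlargement [m L / 4], together less than the
   total [m L] of every [lam (S n)]. *)
have : (hausdorff_content h (rho 0%N / 2) (f @` (\bigcap_n K n)) < (m L / 2)%:E)%E.
  by rewrite (le_lt_trans (content_le_measure _ _ b2))// HK lte_fin divr_gt0.
move=> /content_lt_cover[U [Ud Ucov Usum]].
have m4 : 0 < m L / 4 by rewrite divr_gt0.
have exV j : exists Vd : set Y * R, [/\ open Vd.1, U j `<=` Vd.1,
    0 < Vd.2 /\ Vd.2 < rho 0%N, forall x y, Vd.1 x -> Vd.1 y -> mdist x y <= Vd.2 &
    ((h Vd.2)%:E <= hausdorff_gauge h (U j) + (m L / 4 / (2 ^ j.+1)%:R)%:E)%E].
  have [|||V [d VP]] := gauge_open_enlarge h_haus h0 (Ud j)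
    (b := rho 0%N) (e := m L / 4 / (2 ^ j.+1)%:R).
  - exact: ltW.
  - by have := rho0 0%N; lra.
  - by rewrite divr_gt0// ltr0n expn_gt0.
  - by exists (V, d).
have [Vd VdP] := choice exV.
have exW j : exists W, open W /\ L `&` f @^-1` (Vd j).1 = L `&` W.
  by have [oV _ _ _ _] := VdP j; have [W oW WE] := L_cont oV; exists W.
have [W WP] := choice exW.
(* These open sets increase and cover [L], so compactness yields one [n] for which finitely many
   [W j] already cover the stage [K n], not just the limit set. *)
pose O n := \bigcup_(j in `I_n.+1) W j `|` ~` K n.
have [||||n LO] := @compact_increasing_cover _ L O.
- by [].
- move=> n; apply: openU; last exact: closed_openC.
  by apply: bigcup_open => j _; have [] := WP j.
- move=> i j ij x [[k /= ki Wx]|nK]; last by right => /(Kmono _ _ ij).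
  by left; exists k => //=; rewrite ltnS; apply: leq_trans ij.
- move=> x Lx; have [Kx|/existsNP[n /not_implyP[_ nKx]]] := pselect ((\bigcap_n K n) x).
    have [|j _ Ux] := Ucov (f x); first by exists x.
    exists j => //; left; exists j => //=.
    have [_ WE] := WP j; suff : (L `&` W j) x by case.
    by rewrite -WE; split => //; have [_ + _ _ _] := VdP j; apply.
  by exists n => //; right.
have cover : lam (S n) setT <=
    lam (S n) (\big[setU/set0]_(0 <= j < n.+1) (f @^-1` (Vd j).1)).
  rewrite /lam big_seq [leRHS]big_seq; apply: ler_sum => p pS.
  have [p0 _ pL] := aS _ _ pS; rewrite ler_wpM2l// setIT; apply: m_mono => x [_ px].
  split => //; rewrite big_mkord -(bigcup_mkord n.+1 (fun j => f @^-1` (Vd j).1)).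
  have Kx : K n x by apply/carrierP; exists p.
  have [[j /= jn Wx]|//] := LO x (pL _ px).
  exists j => //; have [_ WE] := WP j.
  suff : (L `&` f @^-1` (Vd j).1) x by case.
  by rewrite WE; split => //; exact: pL.
have lam_big (F : nat -> set X) k : lam (S n) (\big[setU/set0]_(0 <= j < k) F j) <=
    \sum_(0 <= j < k) lam (S n) (F j).
  elim: k => [|k ih].
    by rewrite !big_geq// /lam big1// => p _; rewrite setI0 m0 mulr0.
  by rewrite !big_nat_recr//= (le_trans (lamU _ _ _))// lerD2r.
have : ((m L)%:E <= (m L / 2)%:E + (m L / 4)%:E)%E.
  apply: (@le_trans _ _ (\sum_(0 <= j < n.+1) (h (Vd j).2)%:E)%E).
    rewrite sumEFin lee_fin -(lamT n) (le_trans cover)// (le_trans (lam_big _ _))//.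
    apply: ler_sum => j _; have [_ _ [d0 dr] Vx _] := VdP j.
    exact: lam_h.
  apply: (@le_trans _ _ (\sum_(0 <= j < n.+1) (hausdorff_gauge h (U j) +
      (m L / 4 / (2 ^ j.+1)%:R)%:E))%E).
    by apply: lee_sum => j _; have [] := VdP j.
  apply: (@le_trans _ _ (\sum_(j <oo) (hausdorff_gauge h (U j) +
      (m L / 4 / (2 ^ j.+1)%:R)%:E))%E).
    apply: nneseries_lim_ge => j _ _; rewrite adde_ge0//; first exact: gauge_ge0.
    by rewrite lee_fin divr_ge0// ltW.
  apply: le_trans (epsilon_trick xpredT _ (ltW m4)) _.
    by move=> j; exact: gauge_ge0.
  by apply: leeD => //; exact: ltW.
by rewrite -EFinD lee_fin; lra.
Qed.

End cantor.

(** * Egorov's argument and the conclusion *)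

Lemma low_density_null {R : realType} {X : topologicalType} {Y : metricType R}
    (mu : {outer_measure set X -> \bar R}) (f : X -> Y) (h : R -> R) (L : set X) :
  (forall C : set X, closed C -> mu.-caratheodory C) ->
  (forall (E : set X) (e : R), mu.-caratheodory E -> (mu E < +oo)%E -> 0 < e ->
    exists C, [/\ closed C, C `<=` E & (mu (E `\` C) <= e%:E)%E]) ->
  outer_measurable_fun mu f -> hausdorff_function h -> finite_order h -> h 0 = 0 ->
  (forall N, mu N = 0%E -> hausdorff_measure h (f @` N) = 0%E) ->
  compact L -> closed L -> (mu L < +oo)%E -> relatively_continuous L f ->
  mu (L `&` f @^-1` (\bigcap_n \bigcup_m low_density mu f h L n m)) = 0%E.
Proof.
move=> mu_closed mu_inner f_meas h_haus h_fo h0 null_image Lc Lcl Loo Lf.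
have [h_ge0 h_nd _ h_pos] := h_haus.
set A := low_density mu f h L; set E0 := L `&` _.
have fA n m : mu.-caratheodory (f @^-1` A n m).
  rewrite -(setCK (A n m)) preimage_setC; apply: caratheodory_measurable_setC.
  exact: (f_meas (~` A n m) (closed_openC (@low_density_closed _ _ _ _ _ _ _ n m))).
have mE0 : mu.-caratheodory E0.
  apply: caratheodory_measurable_setI; first exact: mu_closed.
  rewrite preimage_bigcap; apply: caratheodory_measurable_bigcap => n.
  by rewrite preimage_bigcup; apply: caratheodory_measurable_bigcup => m.
have E0oo : (mu E0 < +oo)%E.
  by apply: le_lt_trans Loo; apply: le_outer_measure; exact: subIsetl.
apply/eqP; rewrite eq_le outer_measure_ge0 andbT leNgt; apply/negP => E0pos.
(* A loss of half the measure still leaves a positive part; this is used for the Egorov set and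
   again for its closed approximation. *)
have half (E : set X) : (0 < mu E)%E -> (mu E < +oo)%E -> exists e : R, 0 < e /\
    forall F, (mu (E `\` F) <= e%:E)%E -> (0 < mu (E `&` F))%E.
  move=> E1 Eoo; have Efin : mu E \is a fin_num by rewrite ge0_fin_numE// ltW.
  have fE : 0 < fine (mu E) by rewrite fine_gt0// E1.
  exists (fine (mu E) / 2); split => [|F FE]; first by rewrite divr_gt0.
  rewrite lt_neqAle outer_measure_ge0 andbT; apply/eqP => EF.
  have := le_outer_measureIC mu F E; rewrite -EF add0e -setDE => /le_trans/(_ FE).
  by rewrite -(fineK Efin) lee_fin; lra.
have [e [e0 eP]] := half _ E0pos E0oo.
(* Egorov's choice: for each density bound one scale [m] works off a set of measure at most
   [e / 2 ^ n.+1], and these losses sum to at most [e]. *)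
have ex n : exists m, (mu (E0 `\` f @^-1` A n m) <= (e / (2 ^ n.+1)%:R)%:E)%E.
  have e'0 : 0 < e / (2 ^ n.+1)%:R by rewrite divr_gt0// ltr0n expn_gt0.
  have [|||m /ltW mP] := caratheodory_setD_lt E0oo (D := fun m => f @^-1` A n m) _ _ _ e'0.
  - exact: fA.
  - by move=> m m' mm'; apply/subsetPset => x; exact: low_density_mono.
  - by move=> x [_ /(_ n I)].
  - by exists m.
have [M MP] := choice ex.
pose E1 := E0 `&` \bigcap_n f @^-1` A n (M n).
have E1pos : (0 < mu E1)%E.
  apply: eP; rewrite setDE setC_bigcap setI_bigcupr.
  by apply: outer_measure_bigcup_geo => //; exact: ltW.
have E1oo : (mu E1 < +oo)%E.
  by apply: le_lt_trans E0oo; apply: le_outer_measure; exact: subIsetl.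
have mE1 : mu.-caratheodory E1.
  by apply: caratheodory_measurable_setI => //; exact: caratheodory_measurable_bigcap.
have [e1 [e10 e1P]] := half _ E1pos E1oo.
have [L' [cL' L'E L'e]] := mu_inner _ _ mE1 E1oo e10.
have L'L : L' `<=` L by move=> x /L'E[[]].
have [C [t0 [C0 t00 h3]]] := finite_order_doubling h_haus h_fo.
have [||||||N [N0]] := @null_set_positive_image _ _ _ mu f h mu_closed mu_inner
  f_meas h_haus h_fo h0 L'.
- exact: subclosed_compact L'L.
- exact: cL'.
- by apply: le_lt_trans Loo; exact: le_outer_measure.
- move=> O oO; have [W oW WE] := Lf _ oO; exists W => //.
  by rewrite -(setIidl L'L) -!setIA WE.
(* Membership in [low_density] is used with the radii [r] and [2 * r]; then
   [h (2 * r) <= h (3 * r) <= C * h r], and [n] is large enough for [C / n.+1%:R <= a]. *)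
- move=> a a0; pose n := Num.truncn (C / a).
  have Ca : C / n.+1%:R <= a.
    by rewrite ler_pdivrMr// mulrC -ler_pdivrMr// ltW//; exact: truncnS_gt.
  have Mn0 : 0 < (M n).+1%:R^-1 :> R by rewrite invr_gt0.
  exists (Num.min ((M n).+1%:R^-1 / 2) t0); first by rewrite lt_min divr_gt0.
  move=> x r L'x r0; rewrite lt_min => /andP[rM rt].
  apply: (@le_trans _ _ (mu (L `&` f @^-1` ball (f x) r))).
    by apply: le_outer_measure; exact: setSI.
  have [_ /(_ n I) Ax] := L'E _ L'x.
  have rM2 : 2 * r < (M n).+1%:R^-1 by rewrite mulrC -ltr_pdivlMr.
  apply: le_trans (Ax r (2 * r) r0 _ rM2) _; first lra.
  rewrite lee_fin; apply: (@le_trans _ _ (C / n.+1%:R * h r)).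
    rewrite mulrAC ler_pM2r ?invr_gt0//; apply: le_trans (h3 _ r0 rt).
    by apply: h_nd; lra.
  by rewrite ler_wpM2r// h_ge0// ltW.
- by have := e1P _ L'e; rewrite (setIidr L'E).
- by rewrite null_image// ltxx.
Qed.

Theorem theorem1p2 (R : realType) (X : topologicalType)
    (hXreg : regular_T1_space X) (hXsc : @second_countable X)
    (mu : {outer_measure set X -> \bar R})
    (hmuB : borel_outer mu) (hmuG : Gdelta_regular mu)
    (hmusf : sigma_finite_set mu [set: X])
    (hXK : exists (K : nat -> set X) (Z : set X),
        [/\ forall i, compact (K i), mu Z = 0%E
          & [set: X] = (\bigcup_i K i) `|` Z])
    (Y : metricType R) (h : R -> R)
    (hh : hausdorff_function h) (hfo : finite_order h) (hh0 : h 0 = 0)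
    (hY : ~ sigma_finite_set (hausdorff_measure h) [set: Y])
    (f : X -> Y) (hfm : outer_measurable_fun mu f)
    (hfs : forall y : Y, exists x : X, f x = y) :
  exists N : set X, mu N = 0%E /\ (0 < hausdorff_measure h (f @` N))%E.
Proof.
have [h_ge0 h_nd _ _] := hh.
apply: contrapT => nN; apply: hY.
have null_image N : mu N = 0%E -> hausdorff_measure h (f @` N) = 0%E.
  move=> N0; apply/eqP; rewrite eq_le hausdorff_measure_ge0// andbT leNgt.
  by apply/negP => HN; apply: nN; exists N.
have [D [cD Dd]] := separable_codomain hmusf hfm hfs null_image.
have [K [Z [cK Z0 KZ]]] := hXK.
have [L [N [LP N0 LN]]] := compact_continuity_pieces hXreg hXsc hmuB hmuG hfm
  cD Dd hmusf cK Z0 KZ.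
pose A n := low_density mu f h (L n).
pose N' n := L n `&` f @^-1` (\bigcap_k \bigcup_m A n k m).
have N'0 n : mu (N' n) = 0%E.
  have [Lc Lcl Loo Lf] := LP n; apply: low_density_null => //.
    exact: closed_caratheodory.
  exact: inner_closed.
have [p psurj] := nat_pair_surj.
(* Three kinds of pieces cover [Y]: the image of the null remainder, for each [L n] the null image
   of its zero-density part, and for each [n] and [k] a set of high density, of finite measure by
   the Vitali argument. *)
pose G q := match q with
  | (0%N, _) => f @` N
  | (n.+1, 0%N) => f @` N' n
  | (n.+1, k.+1) => ~` \bigcup_m A n k m
  end.
apply: (hausdorff_sigma_finite h_ge0 (E := G \o p)) => [i|].
  rewrite /= /G; case: (p i) => -[|n] [|k]; rewrite ?null_image//.
  have [_ Lcl Loo _] := LP n; apply: high_density_hausdorff_finite => //.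
  exact: closed_caratheodory.
apply/seteqP; split => // y _; have [x fxy] := hfs y.
suff [q Gq] : exists q, G q y by have [i iq] := psurj q; exists i => //=; rewrite iq.
have : ((\bigcup_n L n) `|` N) x by rewrite -LN.
move=> [[n _ Lx]|Nx]; last by exists (0, 0)%N; exists x.
have [Ay|/existsNP[k /not_implyP[_ nAy]]] := pselect ((\bigcap_k \bigcup_m A n k m) y).
  by exists (n.+1, 0)%N; exists x => //; split => //=; rewrite fxy.
by exists (n.+1, k.+1).
Qed.
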